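(* Let $D,\Gamma,\mathcal{M}^{(\Gamma)},\mathcal{M}_2^{(\Gamma)},\mathcal{P}^{(\Gamma)}$, the utility $U$ (satisfying assumptions (A1), (A2), (A3), (A5), (A6)), the constants $\varepsilon,\omega>0$, the logit function $\mathbb{L}_\beta$ and the inverse temperature $\beta(y,\mu)$ be as in the context. Then for every initial condition $\mu_0\in\mathcal{P}^{(\Gamma)}$ the logit dynamic $$\frac{\mathrm{d}\mu_t(A,y)}{\mathrm{d}t}=\int_A \mathbb{L}_{\beta(y,\mu_t)}(z,y,\mu_t)\,\mathrm{d}z-\mu_t(A,y),\qquad t>0,\ y\in\Gamma,\ A\subset D \text{ Borel},$$ admits a unique solution $(\mu_t)_{t\ge 0}$ such that $\mu_t\in\mathcal{P}^{(\Gamma)}$ for all $t\ge 0$.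
   Context: Spaces. $D\subset\mathbb{R}^n$ ($n\in\mathbb{N}$) is a compact domain (the closure of a nonempty bounded connected open set) of Euclidean diameter $1$, and $\Gamma=[0,1]$. The symbol $\mathrm{d}z$ on $D$ denotes Lebesgue measure normalized so that $\int_D\mathrm{d}z=1$. $\mathcal{M}(D)$ is the space of finite signed Borel measures on $D$ with $\|\mu\|_{\mathrm{TV}}=\sup_{|f|\le 1}\left|\int_D f\,\mathrm{d}\mu\right|$ (supremum over measurable $f:D\to\mathbb{R}$ with $|f|\le1$). $\mathcal{M}^{(\Gamma)}$ is the space of families $\mu=\{\mu(\cdot,y)\}_{y\in\Gamma}$ of elements of $\mathcal{M}(D)$ with finite norm $\|\mu\|_{\mathrm{TV}}^{(\Gamma)}=\sup_{y\in\Gamma}\|\mu(\cdot,y)\|_{\mathrm{TV}}$; $\mathcal{M}_2^{(\Gamma)}$ is the subset with $\|\mu\|_{\mathrm{TV}}^{(\Gamma)}\le 2$; $\mathcal{P}^{(\Gamma)}$ is the set of families $\{\mu(\cdot,y)\}_{y\in\Gamma}$ of Borel probability measures on $D$. For $A\subset D$ Borel, $\mu(A,y)$ is the mass that $\mu(\cdot,y)$ gives to $A$. Utility. $U:D\times\Gamma\times\mathcal{M}^{(\Gamma)}\to\mathbb{R}$ satisfies, with positive constants $\bar U,L_D,L_{\mathcal{M}},L_\Gamma,c_U,\Delta U$, for all $x,x_1,x_2\in D$, $y,y_1,y_2\in\Gamma$, $\mu,\nu\in\mathcal{M}_2^{(\Gamma)}$: (A1) $0\le U(x,y,\mu)\le\bar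 U$; (A2) $|U(x_1,y,\mu)-U(x_2,y,\mu)|\le L_D|x_1-x_2|$; (A3) $|U(x,y,\mu)-U(x,y,\nu)|\le L_{\mathcal{M}}\|\mu-\nu\|_{\mathrm{TV}}^{(\Gamma)}$; (A5) $|U(x,y_1,\mu)-U(x,y_2,\mu)|\le L_\Gamma|y_1-y_2|$; (A6) $x\mapsto U(x,y,\mu)$ has a finite number of strict local maximum points $x'$, at each of which $U(x',y,\mu)-U(x,y,\mu)=c_U|x-x'|+o(|x-x'|)$ as $x\to x'$; and $\max_{x\in D}U(x,y,\mu)-\min_{x\in D}U(x,y,\mu)\ge\Delta U$. Logit function. Fix $\varepsilon>0$ and $\omega>0$. For $\beta\ge0$, $$\mathbb{L}_\beta(x,y,\mu)=\frac{\exp(\beta U(x,y,\mu))}{\int_D\exp(\beta U(z,y,\mu))\,\mathrm{d}z},$$ and for $(y,\mu)\in\Gamma\times\mathcal{M}_2^{(\Gamma)}$, $\beta(y,\mu)$ is the unique $\beta\ge0$ solving $$\int_D\left\{\mathbb{L}_\beta(z,y,\mu)\ln\mathbb{L}_\beta(z,y,\mu)-\left(\mathbb{L}_\beta(z,y,\mu)-1\right)\right\}\mathrm{d}z+\omega\beta=\varepsilon.$$ Solution. A solution with initial condition $\mu_0$ is a family $(\mu_t)_{t\ge0}$ starting at $\mu_0$ such that for all Borel $A\subset D$ and $y\in\Gamma$ the map $t\mapsto\mu_t(A,y)$ is continuous on $[0,\infty)$, differentiable for $t>0$, and satisfies the displayed equation. *)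

(* Defs.v *)
From HB Require Import structures.
From mathcomp Require Import all_boot all_order all_algebra.
From mathcomp Require Import all_classical all_reals all_analysis.
From mathcomp Require Import measurable_realfun.
Set Implicit Arguments.
Unset Strict Implicit.
Unset Printing Implicit Defensive.
Import Order.TTheory GRing.Theory Num.Theory.
Import numFieldNormedType.Exports.
Local Open Scope classical_set_scope.
Local Open Scope ring_scope.

Section borel_rV.
Context (R : realType) (n : nat).

HB.instance Definition _ := @isMeasurable.Build
  (sigma_display (@open 'rV[R]_n)) 'rV[R]_n <<s @open 'rV[R]_n >>
  (@sigma_algebra0 _ setT (@open 'rV[R]_n))
  (fun A mA => eq_ind _ <<s @open 'rV[R]_n >>
     (sigma_algebraCD mA) _ (setTD A))
  (@sigma_algebra_bigcup _ setT (@open 'rV[R]_n)).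

Lemma open_measurable_rV (A : set 'rV[R]_n) : open A -> measurable A.
Proof. exact: sub_sigma_algebra. Qed.

Lemma measurable_fun_rV d (T : measurableType d) (f : T -> 'rV[R]_n) :
  (forall i, measurable_fun setT (fun x => f x ord0 i)) ->
  measurable_fun setT f.
Proof.
move=> mf; apply: (@measurability _ _ T _ setT f (@open 'rV[R]_n) erefl).
move=> C [U oU <-].
rewrite setTI.
pose B (p : 'rV[rat]_n * nat) : set 'rV[R]_n :=
  [set y | forall i, ball (ratr (p.1 ord0 i) : R) (p.2.+1%:R^-1) (y ord0 i)].
have -> : U = \bigcup_p (if `[< B p `<=` U >] then B p else set0).
  apply/seteqP; split => [y Uy|y [p _]]; last by case: asboolP => // pU /pU.
  have /nbhs_ballP[e /= e0 yeU] : nbhs y U by apply: open_nbhs_nbhs; split.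
  have [k ke] : exists k : nat, k.+1%:R^-1 < e / 2 :> R.
    have e20 : 0 < e / 2 by rewrite divr_gt0.
    have [k _ /(_ k (leqnn k))] := near_infty_natSinv_lt (PosNum e20).
    by exists k.
  have k0 : 0 < k.+1%:R^-1 :> R by rewrite invr_gt0.
  have hq i : exists q : rat, ball (y ord0 i) (k.+1%:R^-1) (ratr q : R).
    have [|q qi] := @rat_in_itvoo R (y ord0 i - k.+1%:R^-1)
      (y ord0 i + k.+1%:R^-1); first by rewrite ltrBlDr -addrA ltrDl addr_gt0.
    exists q; rewrite /ball /= ltr_distlC.
    by move: qi; rewrite in_itv.
  exists (\row_i sval (cid (hq i)), k) => //; case: asboolP => [_|].
    by move=> i /=; rewrite mxE; case: cid => q /= /ball_sym.
  apply: contra_notP => _ z Bz; apply: yeU; split => // i j; rewrite !ord1.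
  have := Bz j; rewrite /= mxE; case: cid => q /= yq qz.
  apply: (@le_ball _ _ (y ord0 j) (k.+1%:R^-1 + k.+1%:R^-1)).
    by rewrite (splitr e) ltW// ltrD.
  exact: ball_triangle yq qz.
rewrite preimage_bigcup; apply: countable_bigcupT_measurable => // p.
case: asboolP => _; last by rewrite preimage_set0.
have -> : f @^-1` B p = \bigcap_(i in setT)
    (fun x => f x ord0 i) @^-1` ball (ratr (p.1 ord0 i) : R) (p.2.+1%:R^-1).
  by apply/seteqP; split => [x Bx i _|x Bx i]; [exact: Bx|exact: (Bx i)].
apply: fin_bigcap_measurable => // i _; rewrite -[X in measurable X]setTI.
by apply: mf => //; exact: measurable_ball.
Qed.

Lemma continuous_measurable_rV (f : 'rV[R]_n -> R) :
  continuous f -> measurable_fun setT f.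
Proof.
move=> /continuousP cf.
apply: (@measurability _ _ _ R setT f _ (RGenOpens.measurableE R)).
move=> _ [_ [a [b ->]] <-]; rewrite setTI; have oab : open `]a, b[%classic by exact: interval_open.
exact: open_measurable_rV (cf _ oab).
Qed.

End borel_rV.

(* The library only provides Lebesgue measure on R; on R^n it is the image of
   the iterated product measure, see [lebesgue_rV_box] for its value on boxes. *)
Section lebesgue_rV.
Context (R : realType).

Section step.
Context (n : nat) (m : {sigma_finite_measure set 'rV[R]_n -> \bar R}).

Definition rV_cons (p : measurableTypeR R * 'rV[R]_n) : 'rV[R]_n.+1 :=
  row_mx (p.1 : R)%:M p.2.

Definition rV_uncons (x : 'rV[R]_n.+1) : measurableTypeR R * 'rV[R]_n :=
  (x ord0 ord0, \row_i x ord0 (lift ord0 i)).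

Lemma rV_consK : cancel rV_cons rV_uncons.
Proof.
move=> [a x]; rewrite /rV_uncons /rV_cons /=; congr pair.
  transitivity (row_mx (a : R)%:M x ord0 (lshift n ord0)).
    by congr (row_mx _ _ _ _); exact/val_inj.
  by rewrite row_mxEl mxE.
apply/rowP => i; rewrite mxE.
transitivity (row_mx (a : R)%:M x ord0 (rshift 1 i)).
  by congr (row_mx _ _ _ _); exact/val_inj.
by rewrite row_mxEr.
Qed.

Lemma measurable_rV_coord k (i : 'I_k) :
  measurable_fun setT (fun x : 'rV[R]_k => x ord0 i).
Proof. by apply: continuous_measurable_rV; exact: coord_continuous. Qed.

Lemma measurable_rV_cons : measurable_fun setT rV_cons.
Proof.
apply: measurable_fun_rV => i; rewrite -(@splitK 1 n i).
case: (@fintype.split 1 n i) => j.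
  rewrite (_ : (fun x => _) = fst); first exact: measurable_fst.
  by apply/funext => p; rewrite [LHS]row_mxEl !ord1 mxE.
rewrite (_ : (fun x => _) = (fun x : 'rV[R]_n => x ord0 j) \o snd).
  exact: measurableT_comp (measurable_rV_coord j) measurable_snd.
by apply/funext => p; rewrite [LHS]row_mxEr.
Qed.

Lemma measurable_rV_uncons : measurable_fun setT rV_uncons.
Proof.
apply/measurable_fun_pair; first exact: measurable_rV_coord.
apply: measurable_fun_rV => i.
by under eq_fun do rewrite mxE; exact: measurable_rV_coord.
Qed.

Definition lebesgue_rV_step : set 'rV[R]_n.+1 -> \bar R :=
  pushforward (@lebesgue_measure R \x m)%E rV_cons.

HB.instance Definition _ := Measure.copy lebesgue_rV_step
  (measure_function_pushforward__canonical__measure_function_Measure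
    (@lebesgue_measure R \x m)%E measurable_rV_cons).

Lemma lebesgue_rV_step_sigma_finite : sigma_finite setT lebesgue_rV_step.
Proof.
have /sigma_finiteP[F [TF ndF Foo]] := sigma_finiteT (@lebesgue_measure R).
have /sigma_finiteP[G [TG ndG Goo]] := sigma_finiteT m.
exists (fun i => rV_uncons @^-1` (F i `*` G i)).
  rewrite -preimage_bigcup (_ : \bigcup_i _ = setT) // predeqE => -[a x].
  split=> // _; have [i _ Fa] : (\bigcup_i F i) a by rewrite -TF.
  have [k _ Gx] : (\bigcup_k G k) x by rewrite -TG.
  exists (maxn i k) => //; split.
    by move: a Fa; exact/subsetPset/ndF/leq_maxl.
  by move: x Gx; exact/subsetPset/ndG/leq_maxr.
move=> i; have [[mF Fi] [mG Gi]] := (Foo i, Goo i); split.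
  rewrite -[X in measurable X]setTI; apply: measurable_rV_uncons => //.
  exact: measurableX.
rewrite /lebesgue_rV_step /pushforward -comp_preimage.
rewrite (_ : _ \o _ = id); last by apply/funext => x /=; rewrite rV_consK.
by rewrite preimage_id product_measure1E// lte_mul_pinfty// ge0_fin_numE.
Qed.

HB.instance Definition _ := Measure_isSigmaFinite.Build _ _ _ lebesgue_rV_step
  lebesgue_rV_step_sigma_finite.

End step.

Fixpoint lebesgue_rV (n : nat) : {sigma_finite_measure set 'rV[R]_n -> \bar R} :=
  if n is k.+1 then lebesgue_rV_step (lebesgue_rV k) else \d_(0 : 'rV[R]_0).

Lemma lebesgue_rV_box (n : nat) (a b : 'rV[R]_n) :
  (forall i, a ord0 i <= b ord0 i) ->
  lebesgue_rV n [set x : 'rV[R]_n | forall i, x ord0 i \in `[a ord0 i, b ord0 i]] =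
  (\prod_i (b ord0 i - a ord0 i))%:E.
Proof.
elim: n a b => [|n IHn] a b ab.
  by rewrite big_ord0 /= diracE mem_set //= => -[].
pose a' : 'rV[R]_n := \row_i a ord0 (lift ord0 i).
pose b' : 'rV[R]_n := \row_i b ord0 (lift ord0 i).
have a'b' i : a' ord0 i <= b' ord0 i by rewrite !mxE.
have := IHn a' b' a'b'; set B := [set x | _] => lB.
have mB : measurable B.
  rewrite (_ : B = \bigcap_(i in setT) (fun x : 'rV[R]_n => x ord0 i) @^-1`
      `[a' ord0 i, b' ord0 i]%classic).
    apply: fin_bigcap_measurable => // i _; rewrite -[X in measurable X]setTI.
    exact: measurable_rV_coord.
  by apply/seteqP; split => [x Bx i _|x Bx i]; [exact: Bx|exact: (Bx i)].
rewrite /= /lebesgue_rV_step /pushforward.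
rewrite (_ : _ @^-1` _ = `[a ord0 ord0, b ord0 ord0]%classic `*` B).
  rewrite product_measure1E//= lB lebesgue_measure_itv/= lte_fin big_ord_recl.
  rewrite EFinM; congr (_ * _)%E.
    case: ltP => [//|ba].
    have -> : b ord0 ord0 = a ord0 ord0 by apply/eqP; rewrite eq_le ba ab.
    by rewrite subrr.
  by congr (_%:E); apply: eq_bigr => i _; rewrite !mxE.
have E1 (p : measurableTypeR R * 'rV[R]_n) : rV_cons p ord0 ord0 = p.1.
  by rewrite -[in RHS](rV_consK p).
have E2 (p : measurableTypeR R * 'rV[R]_n) i :
  rV_cons p ord0 (lift ord0 i) = p.2 ord0 i.
  by rewrite -[in RHS](rV_consK p) /= mxE.
apply/seteqP; split => [p xB|p [p1 p2] i].
  by split => [|i] /=; [rewrite -E1; exact: xB|rewrite !mxE -E2; exact: xB].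
have [j ->|->] := fintype.unliftP ord0 i; last by rewrite E1; exact: p1.
by have := p2 j; rewrite E2 !mxE.
Qed.

End lebesgue_rV.

Section model.
Context (R : realType) (n : nat).
Implicit Types (D A : set 'rV[R]_n) (x z : 'rV[R]_n) (y : {i01 R}).

(* The library's norm on row vectors is the max norm. *)
Definition enorm x : R := Num.sqrt (\sum_i x ord0 i ^+ 2).

Definition compact_domain D :=
  exists O : set 'rV[R]_n,
    [/\ open O, O !=set0, bounded_set O, connected O & D = closure O].

Definition ediameter D : \bar R :=
  ereal_sup [set (enorm (p.1 - p.2))%:E | p in D `*` D].

Lemma inv_volume_ge0 D : 0 <= (fine (lebesgue_rV R n D))^-1.
Proof. by rewrite invr_ge0 fine_ge0. Qed.

(* Lebesgue measure scaled so that D has mass 1. *)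
Definition normalized_lebesgue D : {measure set 'rV[R]_n -> \bar R} :=
  mscale (NngNum (inv_volume_ge0 D)) (lebesgue_rV R n).

(* Integral against a signed measure: the Jordan decomposition. *)
Definition charge_integral (nu : {charge set 'rV[R]_n -> \bar R}) D
    (f : 'rV[R]_n -> R) : \bar R :=
  let: exist P exN := cid (Hahn_decomposition nu) in
  let: exist N nuPN := cid exN in
  (\int[jordan_pos nuPN]_(x in D) (f x)%:E
   - \int[jordan_neg nuPN]_(x in D) (f x)%:E)%E.

Definition tv_norm D (nu : {charge set 'rV[R]_n -> \bar R}) : \bar R :=
  ereal_sup [set `|charge_integral nu D f|%E | f in
    [set f : 'rV[R]_n -> R |
      measurable_fun D f /\ forall x, D x -> `|f x| <= 1]].

(* A finite signed measure on D is represented by a charge on R^n which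
   vanishes outside D. *)
Definition concentrated D (nu : {charge set 'rV[R]_n -> \bar R}) :=
  forall A, measurable A -> A `&` D = set0 -> nu A = 0%E.

Definition measure_family := {i01 R} -> {charge set 'rV[R]_n -> \bar R}.

Definition family_sub (mu nu : measure_family) : measure_family :=
  fun y => cadd (mu y) (copp (nu y)).

Definition family_tv_norm D (mu : measure_family) : \bar R :=
  ereal_sup (range (fun y => tv_norm D (mu y))).

Definition signed_family D (mu : measure_family) :=
  (forall y, concentrated D (mu y)) /\ (family_tv_norm D mu < +oo)%E.

Definition signed_family2 D (mu : measure_family) :=
  signed_family D mu /\ (family_tv_norm D mu <= 2%:E)%E.

Definition prob_family D (mu : measure_family) :=
  forall y, exists P : probability 'rV[R]_n R,
    P D = 1%E /\ forall A, measurable A -> mu y A = P A.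

Definition strict_local_max D (f : 'rV[R]_n -> R) x :=
  D x /\ \forall z \near x, D z -> z != x -> f z < f x.

(* Only the values U x y mu with x in D and mu in [signed_family D] carry
   meaning.  The values of charges on non-measurable sets are irrelevant: by
   [utility_lipschitz_measure] below, U does not see them. *)
Definition utility := 'rV[R]_n -> {i01 R} -> measure_family -> R.

Record utility_assumptions D (U : utility) (Ubar LD LM LG cU DU : R) : Prop := {
  utility_bounds : forall x y mu, D x -> signed_family2 D mu ->
    0 <= U x y mu <= Ubar;
  utility_lipschitz_action : forall x1 x2 y mu, D x1 -> D x2 ->
    signed_family2 D mu ->
    `|U x1 y mu - U x2 y mu| <= LD * enorm (x1 - x2);
  utility_lipschitz_measure : forall x y mu nu, D x ->
    signed_family2 D mu -> signed_family2 D nu ->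
    (`|U x y mu - U x y nu|%:E <= LM%:E * family_tv_norm D (family_sub mu nu))%E;
  utility_lipschitz_parameter : forall x y1 y2 mu, D x -> signed_family2 D mu ->
    `|U x y1 mu - U x y2 mu| <= LG * `|y1%:num - y2%:num|;
  utility_finite_maxima : forall y mu, signed_family2 D mu ->
    finite_set [set x | strict_local_max D (fun z => U z y mu) x];
  utility_conical_maxima : forall x' y mu, signed_family2 D mu ->
    strict_local_max D (fun x => U x y mu) x' ->
    (fun x => U x' y mu - U x y mu) = (fun x => cU * enorm (x - x'))
      +o_ (within D (nbhs x')) (fun x => enorm (x - x'));
  utility_oscillation : forall y mu, signed_family2 D mu ->
    exists xM xm, [/\ D xM, D xm,
      forall x, D x -> U xm y mu <= U x y mu <= U xM y mu &
      DU <= U xM y mu - U xm y mu]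
}.

Definition logit D (U : utility) (beta : R) x y (mu : measure_family) : R :=
  expR (beta * U x y mu) /
  \int[normalized_lebesgue D]_(z in D) expR (beta * U z y mu).

Definition inverse_temperature_eq D (U : utility) (eps omega : R) y
    (mu : measure_family) (beta : R) :=
  \int[normalized_lebesgue D]_(z in D)
    (logit D U beta z y mu * ln (logit D U beta z y mu)
     - (logit D U beta z y mu - 1))
  + omega * beta = eps.

(* The solution beta >= 0 (the left-hand side is increasing in beta); the
   default value 0 would only matter if there were none. *)
Definition inverse_temperature D (U : utility) (eps omega : R) y
    (mu : measure_family) : R :=
  xget 0 [set beta | 0 <= beta /\ inverse_temperature_eq D U eps omega y mu beta].

(* Only the times t >= 0 are meaningful. *)
Definition logit_solution D (U : utility) (eps omega : R) (mu0 : measure_family)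
    (mu : R -> measure_family) :=
  forall A y, measurable A -> A `<=` D ->
    [/\ mu 0 y A = mu0 y A,
        {within `[0, +oo[, continuous (fun t : R => fine (mu t y A))} &
        forall t : R, 0 < t ->
          is_derive t 1 (fun s : R => fine (mu s y A))
            (\int[normalized_lebesgue D]_(z in A)
               logit D U (inverse_temperature D U eps omega y (mu t)) z y (mu t)
             - fine (mu t y A))].

End model.

(* Main.v *)
(* The law [mu_t] is [e^-t mu_0] plus the absolutely continuous part driven by
   the logit densities met along the way, so everything is governed by the map
   sending a curve of densities [l] to the logit response along the solution of
   the linear equation forced by [l].

   At a fixed state, the relative entropy of the Gibbs density is nondecreasing
   in beta (Gibbs' inequality), so the equation for beta has a left-hand side
   growing at rate at least omega.  Hence beta lies in [0, eps / omega] and is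
   Lipschitz in the sup norm of the utility; so is the logit density, and by
   (A3) it is Lipschitz in the total variation distance, which for differences
   of probability measures is at most twice the supremum of the differences over
   Borel sets.

   If two forcing densities differ by at most [a e^(c t)], the linear equations
   they drive differ by at most [a / (c + 1) e^(c t)] on every Borel set.  For
   [c] twice the Lipschitz constant the response map therefore halves weighted
   distances on the whole half line: iterating it converges to a fixed point,
   and two solutions coincide.  Only pointwise bounds enter, so no
   measurability of the supremum over y and A is needed. *)
Require Import Defs.
From HB Require Import structures.
From mathcomp Require Import all_boot all_order all_algebra.
From mathcomp Require Import all_classical all_reals all_analysis.
From mathcomp Require Import measurable_realfun ring lra.
Set Implicit Arguments.
Unset Strict Implicit.
Unset Printing Implicit Defensive.
Import Order.TTheory GRing.Theory Num.Theory.
Import numFieldNormedType.Exports.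
Local Open Scope classical_set_scope.
Local Open Scope ring_scope.

(** * The logit density at a fixed state *)

(** The tangent bound [1 + s <= expR s] at [s = y - x], with [y] the smaller point, multiplied by
    [expR x], which is at most [expR m]. *)
Lemma expR_lipschitz (R : realType) (m x y : R) : x <= m -> y <= m ->
  `|expR x - expR y| <= expR m * `|x - y|.
Proof.
wlog yx : x y / y <= x.
  move=> H xm ym; have [/H|/ltW/H] := leP y x; first exact.
  by rewrite distrC (distrC x); exact.
move=> xm _; rewrite !ger0_norm ?subr_ge0 ?ler_expR//.
have -> : expR y = expR x * expR (y - x) by rewrite -expRD subrKC.
have := expR_ge1Dx (y - x); have := expR_gt0 x; move: xm; rewrite -ler_expR.
set e := expR x; set f := expR (y - x) => em e0 f1.
have : e * (1 - f) <= e * (x - y) by rewrite ler_wpM2l ?(ltW e0)//; lra.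
have : e * (x - y) <= expR m * (x - y) by rewrite ler_wpM2r// subr_ge0.
by lra.
Qed.

(** Tangent inequality at [x] for the convex function [p * ln p - (p - 1)], whose derivative is
    [ln p]; it amounts to [ln s <= s - 1] at [s = x / y]. *)
Lemma entropy_convex (R : realType) (x y : R) : 0 < x -> 0 < y ->
  (y - x) * ln x <= (y * ln y - (y - 1)) - (x * ln x - (x - 1)).
Proof.
move=> x0 y0.
have xy0 : 0 < x / y by rewrite divr_gt0.
have h : -1 < x / y - 1 by lra.
have := le_ln1Dx h; rewrite subrKC.
rewrite ln_div ?posrE// -(ler_pM2l y0).
have -> : y * (x / y - 1) = x - y by field; rewrite gt_eqF.
by lra.
Qed.

Lemma lipschitz_within_continuous (R : realType) (V : normedModType R)
    (A : set V) (f : V -> R) (L : R) :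
  0 <= L -> (forall x y, A x -> A y -> `|f x - f y| <= L * `|x - y|) ->
  {within A, continuous f}.
Proof.
move=> L0 lipf; apply/subspace_continuousP => x Ax.
apply/cvgrPdist_le => e e0; rewrite near_withinE.
have eL : 0 < e / (L + 1) by rewrite divr_gt0// ltr_wpDl.
have : \forall y \near x, `|x - y| < e / (L + 1) by exact: cvgr_dist_lt.
apply: filterS => y /ltW xy Ay; apply: le_trans (lipf _ _ Ax Ay) _.
rewrite (le_trans (ler_wpM2l L0 xy))// mulrCA ler_piMr ?(ltW e0)//.
by rewrite ler_pdivrMr ?ltr_wpDl// mul1r lerDl.
Qed.

(** The tangents at [p] and at [q] enclose the difference between [(p - q) * ln q] and
    [(p - q) * ln p]. *)
Lemma entropy_lipschitz (R : realType) (p q M K : R) : 0 < p -> 0 < q ->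
  `|ln p| <= M -> `|ln q| <= M -> `|p - q| <= K ->
  `|(p * ln p - (p - 1)) - (q * ln q - (q - 1))| <= M * K.
Proof.
move=> p0 q0 l1 l2 pq.
have c1 := entropy_convex p0 q0; have c2 := entropy_convex q0 p0.
have : `|(q - p) * ln p| <= M * K by rewrite normrM mulrC ler_pM// distrC.
have : `|(p - q) * ln q| <= M * K by rewrite normrM mulrC ler_pM.
by rewrite !ler_norml => /andP[? ?] /andP[? ?]; apply/andP; split; lra.
Qed.

(** [s] and [t] are roots of two equations with the same linear part; [x] and [z] are the first
    entropy at [s] and [t], [y] the second one at [t]. Monotonicity of the first entropy lets the
    two be compared at the single point [t]. *)
Lemma root_gap (R : realDomainType) (w e s t x y z : R) :
  x + w * s = e -> y + w * t = e -> x <= z -> w * t - w * s <= `|z - y|.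
Proof. by move=> xe ye xz; apply: le_trans (ler_norm _); lra. Qed.

Lemma ln_sub_mul_ge0 (R : realType) (x y : R) : 0 < x -> 0 < y ->
  0 <= (y - x) * (ln y - ln x).
Proof.
move=> x0 y0; have [xy|/ltW xy] := leP x y.
  by rewrite mulr_ge0 ?subr_ge0// ler_ln.
by rewrite mulr_le0 ?subr_le0// ler_ln.
Qed.

(** Meant for Gibbs densities: [X] and [Y] are partition functions. Dividing by [X >= 1] does not
    increase the error, and the change of denominator is weighted by the second quotient. *)
Lemma quotient_lipschitz (R : realFieldType) (x y X Y C k : R) :
  1 <= X -> 1 <= Y -> 0 <= y / Y <= C -> `|x - y| <= k -> `|X - Y| <= k ->
  `|x / X - y / Y| <= (1 + C) * k.
Proof.
move=> X1 Y1 /andP[q0 qC] xy XY.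
have X0 : X != 0 by rewrite gt_eqF// (lt_le_trans ltr01).
have Y0 : Y != 0 by rewrite gt_eqF// (lt_le_trans ltr01).
have -> : x / X - y / Y = (x - y + (y / Y) * (Y - X)) / X by field; rewrite X0 Y0.
have k0 : 0 <= k by exact: le_trans xy.
rewrite normrM normfV (ger0_norm (le_trans ler01 X1)).
rewrite ler_pdivrMr ?(lt_le_trans ltr01)//.
apply: (@le_trans _ _ ((1 + C) * k)); last first.
  by rewrite ler_peMr// mulr_ge0// addr_ge0// (le_trans q0).
rewrite (le_trans (ler_normD _ _))// mulrDl mul1r lerD//.
by rewrite normrM (ger0_norm q0) distrC ler_pM.
Qed.

(** * Integration of bounded measurable functions over a set of mass one *)

Section bounded_measurable.
Context d (T : measurableType d) (R : realType).
Variables (la : {measure set T -> \bar R}) (D : set T).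
Hypotheses (mD : measurable D) (laD : la D = 1%E).

Definition bounded_measurable (f : T -> R) :=
  measurable_fun D f /\ exists c, forall x, D x -> `|f x| <= c.

Lemma bounded_measurable_cst c : bounded_measurable (cst c).
Proof. by split; [exact: measurable_cst|exists `|c|]. Qed.

Lemma bounded_measurableM f g : bounded_measurable f -> bounded_measurable g ->
  bounded_measurable (fun x => f x * g x).
Proof.
move=> [mf [c fc]] [mg [e ge]]; split; first exact: measurable_funM.
by exists (c * e) => x Dx; rewrite normrM ler_pM ?fc ?ge.
Qed.

Lemma bounded_measurableB f g : bounded_measurable f -> bounded_measurable g ->
  bounded_measurable (fun x => f x - g x).
Proof.
move=> [mf [c fc]] [mg [e ge]]; split; first exact: measurable_funB.
by exists (c + e) => x Dx; rewrite (le_trans (ler_normB _ _))// lerD ?fc ?ge.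
Qed.

Lemma bounded_measurable_expR f : bounded_measurable f ->
  bounded_measurable (fun x => expR (f x)).
Proof.
move=> [mf [c fc]]; split; first exact: measurableT_comp.
exists (expR c) => x Dx; rewrite ger0_norm ?expR_ge0// ler_expR.
exact: le_trans (ler_norm _) (fc _ Dx).
Qed.

Lemma bounded_measurable_eq f g : {in D, f =1 g} -> bounded_measurable f ->
  bounded_measurable g.
Proof.
move=> fg [mf [c fc]]; split; first exact: eq_measurable_fun mf.
by exists c => x Dx; rewrite -fg ?inE//; exact: fc.
Qed.

Lemma bounded_measurable_integrable A f : measurable A -> A `<=` D ->
  bounded_measurable f -> la.-integrable A (EFin \o f).
Proof.
move=> mA AD [mf [c fc]]; apply: (integrableS mD mA AD).
apply: measurable_bounded_integrable => //; first by rewrite [ltLHS]laD ltry.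
by exists c; split; [exact: num_real|move=> e ce x Dx; exact: le_trans (fc _ Dx) (ltW ce)].
Qed.

Lemma Rintegral_cst_prob c : \int[la]_(x in D) c = c.
Proof. by rewrite Rintegral_cst// laD mulr1. Qed.

Lemma fine_measure_le1 A : measurable A -> A `<=` D -> fine (la A) <= 1.
Proof.
move=> mA AD; have lA : (la A <= 1)%E by rewrite -laD le_measure ?inE.
rewrite -lee_fin fineK// ge0_fin_numE//.
by rewrite (le_lt_trans lA)// ltry.
Qed.

Lemma normr_Rintegral_le A f c : measurable A -> A `<=` D ->
  bounded_measurable f -> 0 <= c -> (forall x, D x -> `|f x| <= c) ->
  `|\int[la]_(x in A) f x| <= c.
Proof.
move=> mA AD bf c0 fc.
apply: (le_trans (le_normr_Rintegral mA (bounded_measurable_integrable mA AD bf))).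
apply: (@le_trans _ _ (\int[la]_(x in A) c)).
  apply: le_Rintegral => //.
  - have := integrable_norm (bounded_measurable_integrable mA AD bf).
    by congr (_.-integrable _ _).
  - exact: (bounded_measurable_integrable mA AD (bounded_measurable_cst c)).
  - by move=> x Ax; exact/fc/AD.
by rewrite Rintegral_cst// ler_piMr// fine_measure_le1.
Qed.

Lemma le_Rintegral_bounded f g : bounded_measurable f -> bounded_measurable g ->
  (forall x, D x -> f x <= g x) ->
  \int[la]_(x in D) f x <= \int[la]_(x in D) g x.
Proof. by move=> bf bg fg; apply: le_Rintegral => //; exact: bounded_measurable_integrable. Qed.

Lemma normr_RintegralB_le A f g c : measurable A -> A `<=` D ->
  bounded_measurable f -> bounded_measurable g -> 0 <= c ->
  (forall x, D x -> `|f x - g x| <= c) ->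
  `|\int[la]_(x in A) f x - \int[la]_(x in A) g x| <= c.
Proof.
move=> mA AD bf bg c0 fgc; rewrite -RintegralB//; [|exact: bounded_measurable_integrable..].
by apply: normr_Rintegral_le => //; exact: bounded_measurableB.
Qed.

(** The logit density with the state frozen into [u]. It is convertible to [logit] when [u] is
    [fun z => U z y mu], which [responseE] relies on. *)
Definition gibbs (beta : R) (u : T -> R) z :=
  expR (beta * u z) / \int[la]_(z in D) expR (beta * u z).

(** For a density of mass one the term [p - 1] integrates to zero; it makes the integrand
    nonnegative, with derivative [ln p]. *)
Definition rel_entropy (beta : R) (u : T -> R) :=
  \int[la]_(z in D)
    (gibbs beta u z * ln (gibbs beta u z) - (gibbs beta u z - 1)).

(** * Bounds, monotonicity in the temperature parameter, and Lipschitz estimates for Gibbs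
    densities *)

Section gibbs.
Variables (B b : R).
Hypotheses (B0 : 0 <= B) (b0 : 0 <= b).
Let C := expR (b * B).

Definition utility_fun (u : T -> R) :=
  measurable_fun D u /\ forall x, D x -> 0 <= u x <= B.

Lemma utility_fun_bounded u : utility_fun u -> bounded_measurable u.
Proof.
by move=> [mu uB]; split=> //; exists B => x /uB /andP[u0 uB']; rewrite ger0_norm.
Qed.

Let exp_bm beta u : utility_fun u ->
  bounded_measurable (fun z => expR (beta * u z)).
Proof.
move=> /utility_fun_bounded bu; apply: bounded_measurable_expR.
by apply: bounded_measurableM => //; exact: bounded_measurable_cst.
Qed.

Lemma partition_ge1 beta u : utility_fun u -> 0 <= beta ->
  1 <= \int[la]_(z in D) expR (beta * u z).
Proof.
move=> hu beta0; rewrite -[leLHS]Rintegral_cst_prob.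
apply: le_Rintegral_bounded; [exact: bounded_measurable_cst|exact: exp_bm|].
move=> x Dx; rewrite -expR0 ler_expR mulr_ge0//.
by have [_ /(_ _ Dx)/andP[]] := hu.
Qed.

Let exp_le beta u z : utility_fun u -> 0 <= beta <= b -> D z ->
  expR (beta * u z) <= C.
Proof.
move=> [_ hu] /andP[? ?] /hu /andP[? ?].
by rewrite ler_expR ler_pM.
Qed.

Lemma partition_le beta u : utility_fun u -> 0 <= beta <= b ->
  \int[la]_(z in D) expR (beta * u z) <= C.
Proof.
move=> hu hb; rewrite -[leRHS]Rintegral_cst_prob.
apply: le_Rintegral_bounded; [exact: exp_bm|exact: bounded_measurable_cst|].
by move=> x Dx; exact: exp_le.
Qed.

Lemma gibbs_gt0 beta u z : utility_fun u -> 0 <= beta -> 0 < gibbs beta u z.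
Proof.
move=> hu hb; rewrite divr_gt0 ?expR_gt0//.
exact: lt_le_trans ltr01 (partition_ge1 _ _).
Qed.

Lemma gibbs_le beta u z : utility_fun u -> 0 <= beta <= b -> D z ->
  gibbs beta u z <= C.
Proof.
move=> hu hb Dz; have /andP[hb0 _] := hb; have Z1 := partition_ge1 hu hb0.
rewrite ler_pdivrMr ?(lt_le_trans ltr01)// (le_trans (exp_le hu hb Dz))//.
by rewrite ler_peMr ?expR_ge0.
Qed.

Lemma bounded_measurable_gibbs beta u : utility_fun u ->
  bounded_measurable (gibbs beta u).
Proof.
move=> hu; apply: bounded_measurableM; first exact: exp_bm.
exact: bounded_measurable_cst.
Qed.

Lemma Rintegral_gibbs beta u : utility_fun u -> 0 <= beta ->
  \int[la]_(z in D) gibbs beta u z = 1.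
Proof.
move=> hu hb; rewrite RintegralZr//; last first.
  exact: (bounded_measurable_integrable mD _ (exp_bm beta hu)).
by rewrite divff// gt_eqF// (lt_le_trans ltr01)// partition_ge1.
Qed.

Lemma ln_gibbs beta u z : utility_fun u -> 0 <= beta ->
  ln (gibbs beta u z) = beta * u z - ln (\int[la]_(z in D) expR (beta * u z)).
Proof.
move=> hu hb; have Z1 := partition_ge1 hu hb.
by rewrite ln_div ?posrE ?expR_gt0 ?expRK// (lt_le_trans ltr01).
Qed.

(** The logarithm is the difference of [beta * u z] and the logarithm of the partition function,
    both lying between 0 and [b * B]. *)
Lemma ln_gibbs_norm beta u z : utility_fun u -> 0 <= beta <= b -> D z ->
  `|ln (gibbs beta u z)| <= b * B.
Proof.
move=> hu hb Dz; have /andP[hb0 hb1] := hb; have Z1 := partition_ge1 hu hb0.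
rewrite ln_gibbs//.
have := ln_ge0 Z1.
have ZC := partition_le hu hb.
have : ln (\int[la]_(z in D) expR (beta * u z)) <= b * B.
  by rewrite -(expRK (b * B)) ler_ln// posrE ?expR_gt0// (lt_le_trans ltr01).
have : beta * u z <= b * B by rewrite -ler_expR; exact: exp_le.
have : 0 <= beta * u z.
  by rewrite mulr_ge0//; have [_ /(_ _ Dz)/andP[]] := hu.
by move=> *; rewrite ler_norml; apply/andP; split; lra.
Qed.

Let entropy_bm beta u : utility_fun u -> 0 <= beta -> bounded_measurable
  (fun z => gibbs beta u z * ln (gibbs beta u z) - (gibbs beta u z - 1)).
Proof.
move=> hu hb; have hg := bounded_measurable_gibbs beta hu.
apply: bounded_measurableB.
  apply: bounded_measurableM => //.
  apply: bounded_measurable_eq; first by move=> z _; rewrite ln_gibbs.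
  apply: bounded_measurableB; last exact: bounded_measurable_cst.
  apply: bounded_measurableM; first exact: bounded_measurable_cst.
  exact: utility_fun_bounded.
by apply: bounded_measurableB => //; exact: bounded_measurable_cst.
Qed.

(** The integrand is nonnegative pointwise, its tangent at 1 being the zero line. *)
Lemma rel_entropy_ge0 beta u : utility_fun u -> 0 <= beta ->
  0 <= rel_entropy beta u.
Proof.
move=> hu hb; apply: Rintegral_ge0 => z Dz.
have := entropy_convex ltr01 (gibbs_gt0 z hu hb).
by rewrite ln1; lra.
Qed.

Lemma rel_entropy0 u : utility_fun u -> rel_entropy 0 u = 0.
Proof.
move=> hu; rewrite /rel_entropy -[RHS]Rintegral_cst_prob.
apply: eq_Rintegral => z _; rewrite /gibbs.
under eq_Rintegral do rewrite mul0r expR0.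
by rewrite Rintegral_cst_prob mul0r expR0 divr1 ln1 mulr0 subrr subr0.
Qed.

(* Both steps are instances of Gibbs' inequality: the first difference exceeds
   the linear term [\int (p2 - p1) ln p1 = b1 \int (p2 - p1) u], whose sign is
   that of [\int (p2 - p1) (ln p2 - ln p1)]. *)
Lemma rel_entropy_nondecreasing b1 b2 u : utility_fun u -> 0 <= b1 ->
  b1 <= b2 -> rel_entropy b1 u <= rel_entropy b2 u.
Proof.
move=> hu b10 b12; have b20 := le_trans b10 b12.
move: (b12); rewrite le_eqVlt => /predU1P[->//|lb12].
set p1 := gibbs b1 u; set p2 := gibbs b2 u.
have bu := utility_fun_bounded hu.
have bp1 : bounded_measurable p1 := bounded_measurable_gibbs b1 hu.
have bp2 : bounded_measurable p2 := bounded_measurable_gibbs b2 hu.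
have bdp : bounded_measurable (fun z => p2 z - p1 z) by exact: bounded_measurableB.
have I0 : \int[la]_(z in D) (p2 z - p1 z) = 0.
  rewrite RintegralB//; [|exact: bounded_measurable_integrable..].
  by rewrite !Rintegral_gibbs// subrr.
have bdpu : bounded_measurable (fun z => (p2 z - p1 z) * u z) by exact: bounded_measurableM.
(* Since [p2 - p1] has mean zero, the constant [c] drops out. This allows the logarithms of the
   partition functions to be inserted or removed freely. *)
have aff (a c : R) : \int[la]_(z in D) ((p2 z - p1 z) * (a * u z - c)) =
    a * \int[la]_(z in D) ((p2 z - p1 z) * u z).
  transitivity (\int[la]_(z in D) (a * ((p2 z - p1 z) * u z) - c * (p2 z - p1 z))).
    by apply: eq_Rintegral => z _; ring.
  rewrite RintegralB//; last 2 first.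
  - apply: bounded_measurable_integrable => //.
    by apply: bounded_measurableM => //; exact: bounded_measurable_cst.
  - apply: bounded_measurable_integrable => //.
    by apply: bounded_measurableM => //; exact: bounded_measurable_cst.
  rewrite !RintegralZl//; [|exact: bounded_measurable_integrable..].
  by rewrite I0 mulr0 subr0.
set I := \int[la]_(z in D) ((p2 z - p1 z) * u z) in aff.
have I_ge0 : 0 <= I.
  rewrite -(pmulr_rge0 _ (_ : 0 < b2 - b1)) ?subr_gt0//.
  pose c := ln (\int[la]_(z in D) expR (b2 * u z)) - ln (\int[la]_(z in D) expR (b1 * u z)).
  rewrite -(aff _ c); apply: Rintegral_ge0 => z Dz.
  have -> : (b2 - b1) * u z - c = ln (p2 z) - ln (p1 z).
    rewrite !ln_gibbs// /c; move: (ln (Rintegral _ _ _)) (ln (Rintegral _ _ _)) => c1 c2.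
    by ring.
  by apply: ln_sub_mul_ge0; exact: gibbs_gt0.
rewrite -subr_ge0 /rel_entropy -RintegralB//; last 2 first.
- by apply: bounded_measurable_integrable => //; exact: entropy_bm.
- by apply: bounded_measurable_integrable => //; exact: entropy_bm.
apply: (@le_trans _ _ (\int[la]_(z in D) ((p2 z - p1 z) *
    (b1 * u z - ln (\int[la]_(z in D) expR (b1 * u z)))))).
  by rewrite aff mulr_ge0.
apply: le_Rintegral_bounded.
- apply: bounded_measurableM => //; apply: bounded_measurableB; last exact: bounded_measurable_cst.
  by apply: bounded_measurableM => //; exact: bounded_measurable_cst.
- by apply: bounded_measurableB; exact: entropy_bm.
- by move=> z Dz; rewrite -ln_gibbs//; apply: entropy_convex; exact: gibbs_gt0.
Qed.

Section lipschitz.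
Variables (u v : T -> R) (dl : R).
Hypotheses (hu : utility_fun u) (hv : utility_fun v).
Hypotheses (dl0 : 0 <= dl) (uv : forall z, D z -> `|u z - v z| <= dl).
Variables (beta gamma : R).
Hypotheses (hbeta : 0 <= beta <= b) (hgamma : 0 <= gamma <= b).
(** Bounds the gap between the exponents [beta * u z] and [gamma * v z], split as [(beta - gamma) *
    u z + gamma * (u z - v z)]. *)
Let kappa := B * `|beta - gamma| + b * dl.

Lemma exp_utility_lipschitz z : D z ->
  `|expR (beta * u z) - expR (gamma * v z)| <= C * kappa.
Proof.
move=> Dz; apply: le_trans (expR_lipschitz (m := b * B) _ _) _.
- by have := exp_le hu hbeta Dz; rewrite ler_expR.
- by have := exp_le hv hgamma Dz; rewrite ler_expR.
rewrite ler_wpM2l ?expR_ge0//.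
have -> : beta * u z - gamma * v z = (beta - gamma) * u z + gamma * (u z - v z) by ring.
rewrite (le_trans (ler_normD _ _))// !normrM lerD//.
  rewrite mulrC ler_wpM2r//.
  by have [_ /(_ _ Dz)/andP[u0 uB]] := hu; rewrite ger0_norm.
rewrite ler_pM//; last exact: uv.
by case/andP: hgamma => *; rewrite ger0_norm.
Qed.

(** Numerator and partition function both move by at most [C * kappa]; [quotient_lipschitz] supplies
    the factor [1 + C]. *)
Lemma gibbs_lipschitz z : D z ->
  `|gibbs beta u z - gibbs gamma v z| <= (1 + C) * C * kappa.
Proof.
move=> Dz; have /andP[beta0 _] := hbeta; have /andP[gamma0 _] := hgamma.
have Z1 := partition_ge1 hu beta0; have Z2 := partition_ge1 hv gamma0.
have gC := gibbs_le hv hgamma Dz; have g0 := gibbs_gt0 z hv gamma0.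
have e1 := exp_utility_lipschitz Dz.
have C0 : 0 <= C by exact: expR_ge0.
have k0 : 0 <= kappa by rewrite addr_ge0// mulr_ge0.
have e2 : `|\int[la]_(z in D) expR (beta * u z) -
    \int[la]_(z in D) expR (gamma * v z)| <= C * kappa.
  apply: normr_RintegralB_le => //; [exact: exp_bm..|by rewrite mulr_ge0|].
  by move=> x Dx; exact: exp_utility_lipschitz.
rewrite -mulrA; apply: quotient_lipschitz => //.
by apply/andP; split=> //; exact: ltW.
Qed.

Lemma rel_entropy_lipschitz :
  `|rel_entropy beta u - rel_entropy gamma v| <= b * B * ((1 + C) * C * kappa).
Proof.
have /andP[beta0 _] := hbeta; have /andP[gamma0 _] := hgamma.
apply: normr_RintegralB_le => //; [exact: entropy_bm..| |].
  by rewrite !(mulr_ge0,addr_ge0)// ?expR_ge0.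
move=> z Dz.
have l1 := ln_gibbs_norm hu hbeta Dz; have l2 := ln_gibbs_norm hv hgamma Dz.
have gl := gibbs_lipschitz Dz.
have p0 := gibbs_gt0 z hu beta0; have q0 := gibbs_gt0 z hv gamma0.
exact: entropy_lipschitz.
Qed.

End lipschitz.
End gibbs.

(** * The inverse temperature and the resulting logit density *)

Section temperature.
Variables (B eps omega : R).
Hypotheses (B0 : 0 <= B) (eps0 : 0 < eps) (omega0 : 0 < omega).
(** Every root of the temperature equation is at most [b], because the entropy is nonnegative. *)
Let b := eps / omega.
Let C := expR (b * B).
Let b0 : 0 <= b. Proof. by rewrite divr_ge0// ltW. Qed.

(** By [temperature_exists] the default value of [xget] is never taken when [u] is a
    [utility_fun B]. *)
Definition temperature u : R :=
  xget 0 [set beta | 0 <= beta /\ rel_entropy beta u + omega * beta = eps].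

(** Intermediate value theorem on [[0, b]]: the left-hand side vanishes at 0 and is at least [eps]
    at [b]. Continuity is [rel_entropy_lipschitz] with equal utilities and [dl = 0]. *)
Lemma temperature_exists u : utility_fun B u ->
  exists beta, 0 <= beta /\ rel_entropy beta u + omega * beta = eps.
Proof.
move=> hu.
have [|||beta] := @IVT R (fun beta => rel_entropy beta u + omega * beta) 0 b eps.
- exact: b0.
- have cont : {within `[0, b], continuous (fun beta => rel_entropy beta u + omega * beta)}.
    pose L := b * B * ((1 + C) * C * B) + omega.
    have C0 : 0 <= C by exact: expR_ge0.
    have K0 : 0 <= b * B * ((1 + C) * C * B).
      by apply: mulr_ge0; do ?apply: mulr_ge0 => //; exact: addr_ge0.
    have L0 : 0 < L by exact: ltr_wpDl.
    have clip x y : `[0, b]%classic x -> `[0, b]%classic y ->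
      `|(rel_entropy x u + omega * x) - (rel_entropy y u + omega * y)| <= L * `|x - y|.
      rewrite /= !in_itv/= => hx hy.
      have := @rel_entropy_lipschitz B b B0 b0 u u 0 hu hu (lexx _) _ x y hx hy.
      rewrite mulr0 addr0 => /(_ _)/wrap[]; first by move=> z _; rewrite subrr normr0.
      move=> h; rewrite opprD addrACA -mulrBr.
      rewrite (le_trans (ler_normD _ _))// mulrDl lerD//; first by rewrite (le_trans h)// -!mulrA.
      by rewrite normrM (gtr0_norm omega0).
    exact: (lipschitz_within_continuous (ltW L0) clip).
  exact: cont.
- rewrite (rel_entropy0 hu) mulr0 addr0 /b mulrCA divff ?gt_eqF// mulr1.
  have := rel_entropy_ge0 hu b0; set r := rel_entropy _ _ => r0.
  by rewrite ge_min le_max (ltW eps0)/= lerDr r0 orbT.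
by rewrite in_itv/= => /andP[beta0 _] h; exists beta.
Qed.

Lemma temperatureP u : utility_fun B u -> 0 <= temperature u /\
  rel_entropy (temperature u) u + omega * temperature u = eps.
Proof. by move=> /temperature_exists/(xgetPex 0). Qed.

Lemma temperature_bounds u : utility_fun B u -> 0 <= temperature u <= b.
Proof.
move=> /[dup] hu /temperatureP[t0 te].
rewrite t0/= ler_pdivlMr// mulrC.
have := rel_entropy_ge0 hu t0; move: te.
by move: (rel_entropy _ _) => x; move: (temperature u) => y; lra.
Qed.

(** Both entropies are compared at the larger of the two roots, so the temperature part of the
    exponent gap vanishes and only [b * dl] remains; the slope [omega] of the linear term turns this
    into a bound on the roots. *)
Lemma temperature_lipschitz u v dl : utility_fun B u -> utility_fun B v ->
  0 <= dl -> (forall z, D z -> `|u z - v z| <= dl) ->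
  `|temperature u - temperature v| <=
    b * B * ((1 + C) * C * (b * dl)) / omega.
Proof.
move=> hu hv dl0 uv.
wlog tuv : u v hu hv uv / temperature u <= temperature v.
  move=> H; have [tuv|/ltW tvu] := leP (temperature u) (temperature v).
    exact: H.
  by rewrite distrC; apply: H => // z Dz; rewrite distrC; exact: uv.
rewrite ler_pdivlMr// distrC ger0_norm ?subr_ge0// mulrC mulrBr.
have [tu0 tue] := temperatureP hu.
have [tv0 tve] := temperatureP hv.
have mono := rel_entropy_nondecreasing hu tu0 tuv.
have hb := temperature_bounds hv.
have := @rel_entropy_lipschitz B b B0 b0 u v dl hu hv dl0 uv _ _ hb hb.
rewrite (subrr (temperature v)) normr0 mulr0 add0r; apply: le_trans.
exact: root_gap tue tve mono.
Qed.

Definition logit_choice u := gibbs (temperature u) u.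

Lemma bounded_measurable_logit_choice u : utility_fun B u ->
  bounded_measurable (logit_choice u).
Proof. exact: bounded_measurable_gibbs. Qed.

Lemma Rintegral_logit_choice u : utility_fun B u ->
  \int[la]_(z in D) logit_choice u z = 1.
Proof.
by move=> hu; have /andP[t0 _] := temperature_bounds hu; exact: Rintegral_gibbs hu t0.
Qed.

Lemma logit_choice_bounds u z : utility_fun B u -> D z ->
  0 <= logit_choice u z <= C.
Proof.
move=> hu Dz; have hb := temperature_bounds hu; have /andP[hb0 _] := hb.
by rewrite (gibbs_le (B := B) (b := b))// ltW// (gibbs_gt0 _ hu).
Qed.

Lemma logit_choice_lipschitz : exists2 K, 0 <= K & forall u v dl,
  utility_fun B u -> utility_fun B v ->
  0 <= dl -> (forall z, D z -> `|u z - v z| <= dl) ->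
  forall z, D z -> `|logit_choice u z - logit_choice v z| <= K * dl.
Proof.
(* [M] is the Lipschitz constant of the temperature; inserted into the exponent gap it gives
   [(B * M + b) * dl]. *)
pose M := b * B * ((1 + C) * C * b) / omega.
have C0 : 0 <= C by exact: expR_ge0.
have C1 : 0 <= (1 + C) * C by rewrite mulr_ge0// addr_ge0.
have M0 : 0 <= M.
  apply: divr_ge0; last exact: ltW.
  by apply: mulr_ge0; exact: mulr_ge0.
exists ((1 + C) * C * (B * M + b)).
  by apply: mulr_ge0 => //; rewrite addr_ge0// mulr_ge0.
move=> u v dl hu hv dl0 uv z Dz.
have hbu := temperature_bounds hu; have hbv := temperature_bounds hv.
apply: le_trans (gibbs_lipschitz B0 b0 hu hv dl0 uv hbu hbv Dz) _.
rewrite -/C -[leRHS]mulrA; apply: ler_wpM2l => //.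
rewrite mulrDl lerD2r -mulrA; apply: ler_wpM2l => //.
apply: le_trans (temperature_lipschitz hu hv dl0 uv) _.
rewrite /M; move: ((1 + C) * C) => k.
suff -> : b * B * (k * (b * dl)) / omega = b * B * (k * b) / omega * dl by [].
ring.
Qed.

(** Temperature and partition function are the same at both points, so only the numerator varies.
    This transfers Lipschitz continuity in the action from the utility to the density. *)
Lemma logit_choice_lipschitz_space u : utility_fun B u -> forall z z', D z -> D z' ->
  `|logit_choice u z - logit_choice u z'| <= C * b * `|u z - u z'|.
Proof.
move=> hu z z' Dz Dz'; have hb := temperature_bounds hu.
have /andP[hb0 hb1] := hb; have Z1 := partition_ge1 hu hb0.
rewrite /logit_choice /gibbs -mulrBl normrM normfV.
rewrite (ger0_norm (le_trans ler01 Z1)) ler_pdivrMr ?(lt_le_trans ltr01)//.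
have e x : D x -> temperature u * u x <= b * B.
  by move=> Dx; have [_ /(_ _ Dx)/andP[? ?]] := hu; rewrite ler_pM.
apply: (le_trans (expR_lipschitz (e _ Dz) (e _ Dz'))).
rewrite -mulrBr normrM (ger0_norm hb0) -/C mulrA.
apply: le_trans (_ : C * b * `|u z - u z'| <= _).
  by rewrite ler_wpM2r// ler_wpM2l// expR_ge0.
by rewrite ler_peMr// mulr_ge0// mulr_ge0// expR_ge0.
Qed.
End temperature.
End bounded_measurable.

(** * The scalar equation g' = r - g *)

Section linear_ode.
Variable R : realType.

(** Integrating factor: [expR * g] has derivative [expR t * r t >= 0]. *)
Lemma linear_ode_ge0 (g r : R -> R) : {within `[0, +oo[, continuous g} ->
  g 0 = 0 -> (forall t : R, 0 < t -> is_derive t 1 g (r t - g t)) ->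
  (forall t : R, 0 < t -> 0 <= r t) -> forall t : R, 0 <= t -> 0 <= g t.
Proof.
move=> cg g0 dg r0 t t0.
pose h := (@expR R) * g.
have dh (x : R) : 0 < x -> is_derive x 1 h (expR x * r x).
  move=> x0; have := dg _ x0 => dgx.
   apply: (is_derive_eq (is_deriveM (is_derive_expR x) dgx)).
  rewrite /GRing.scale/=; ring.
have : h 0 <= h t.
  apply: (@ger0_derive1_ndecry _ h 0) => //.
  - by move=> x; rewrite in_itv/= andbT => /dh[].
  - move=> x; rewrite in_itv/= andbT => x0.
    by rewrite derive1E; have [_ ->] := dh _ x0; rewrite mulr_ge0 ?expR_ge0 ?r0.
  - move=> x; apply: continuousM; last exact: cg.
    by apply: continuous_subspaceT; exact: continuous_expR.
by rewrite /h !fctE g0 mulr0 pmulr_rge0 ?expR_gt0.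
Qed.

Lemma is_derive_expRM (c t : R) :
  is_derive t 1 (fun t => expR (c * t)) (c * expR (c * t)).
Proof.
have h : is_derive t 1 (fun t => c * t) c.
  by apply: (is_derive_eq (is_deriveZ c (is_derive_id t 1))); rewrite /GRing.scale/= mulr1.
apply: (is_derive_eq (is_derive1_comp (is_derive_expR (c * t)) h)).
by rewrite /GRing.scale/= mulrC.
Qed.

(** Comparison with [E], the solution of [E' = a * expR (c * t) - E] that vanishes at 0. The factor
    [1 / (c + 1)] gained here is the source of the contraction. *)
Lemma linear_ode_le (g r : R -> R) (a c : R) : 0 <= a -> 0 <= c ->
  {within `[0, +oo[, continuous g} -> g 0 = 0 ->
  (forall t : R, 0 < t -> is_derive t 1 g (r t - g t)) ->
  (forall t : R, 0 < t -> r t <= a * expR (c * t)) ->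
  forall t : R, 0 <= t -> g t <= a / (c + 1) * expR (c * t).
Proof.
move=> a0 c0 cg g0 dg rle t t0.
have c1 : 0 < c + 1 by rewrite ltr_wpDl.
set k := a / (c + 1).
have k0 : 0 <= k by rewrite divr_ge0// ltW.
pose E (t : R) := k * (expR (c * t) - expR (-1 * t)).
pose G : R -> R := E - g.
have hE (x : R) : is_derive x 1 E
    (k * (c * expR (c * x) + expR (-1 * x))).
  apply: (is_derive_eq (is_deriveZ k (is_deriveB (is_derive_expRM c x) (is_derive_expRM (-1) x)))).
  by rewrite /GRing.scale/=; ring.
have : 0 <= G t.
  apply: (@linear_ode_ge0 G (fun t => a * expR (c * t) - r t) _ _ _ _ t t0).
  - move=> x; apply: continuousB; last exact: cg.
    apply: continuous_subspaceT => y.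
    by apply: differentiable_continuous; apply/derivable1_diffP; have [] := hE y.
  - by rewrite /G /E !fctE g0 !mulr0 !subrr mulr0 subrr.
  - move=> x x0; have dgx := dg _ x0.
    apply: (is_derive_eq (is_deriveB (hE x) dgx)).
    have -> : a = k * (c + 1) by rewrite /k mulfVK// gt_eqF.
    by rewrite /G /E !fctE; ring.
  - by move=> x x0; rewrite subr_ge0 rle.
rewrite /G !fctE subr_ge0 => /le_trans; apply; rewrite ler_wpM2l// gerBl.
exact: expR_ge0.
Qed.

Lemma linear_ode_norm (g r : R -> R) (a c : R) : 0 <= a -> 0 <= c ->
  {within `[0, +oo[, continuous g} -> g 0 = 0 ->
  (forall t : R, 0 < t -> is_derive t 1 g (r t - g t)) ->
  (forall t : R, 0 < t -> `|r t| <= a * expR (c * t)) ->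
  forall t : R, 0 <= t -> `|g t| <= a / (c + 1) * expR (c * t).
Proof.
move=> a0 c0 cg g0 dg rle t t0; rewrite ler_norml; apply/andP; split; last first.
  apply: (linear_ode_le a0 c0 cg g0 dg _ t0) => x /rle.
  exact/le_trans/ler_norm.
rewrite lerNl -[- g t]/((- g) t).
apply: (@linear_ode_le (- g) (fun t => - r t) _ _ a0 c0 _ _ _ _ _ t0).
- by move=> x; apply: continuousN; exact: cg.
- by rewrite fctE g0 oppr0.
- by move=> x x0; rewrite fctE -opprD; apply: is_deriveN; exact: dg.
- by move=> x /rle; apply: le_trans; rewrite -normrN ler_norm.
Qed.

Lemma primitive_exists (f : R -> R) : continuous f ->
  exists2 F : R -> R, F 0 = 0 & forall t : R, -1 < t -> is_derive t 1 F (f t).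
Proof.
(* Integrating from -1 makes the derivative two-sided at time 0 as well; subtracting [G 0] restores
   the initial value. *)
move=> cf; pose G x := \int[@lebesgue_measure R]_(t in `[-1, x]) f t.
exists (fun x => G x - G 0); first by rewrite subrr.
move=> t t1.
have [||||dG G'] := @continuous_FTC1 R f (BLeft (-1)) t (t + 1).
- by rewrite ltrDl.
- apply: continuous_compact_integrable; first exact: segment_compact.
  exact: continuous_subspaceT.
- exact: t1.
- exact: cf.
have hG : is_derive t 1 G (f t) 
  by apply: DeriveDef; [exact: dG|rewrite -derive1E; exact: G'].
have := is_deriveB hG (is_derive_cst (G 0) t 1).
by rewrite subr0; exact.
Qed.

(** Variation of constants: [expR (- t)] times the primitive of [expR t * f t]. *)
Lemma linear_ode_exists (f : R -> R) : continuous f ->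
  exists2 g : R -> R, g 0 = 0 & forall t : R, -1 < t -> is_derive t 1 g (f t - g t).
Proof.
move=> cf.
have [|F F0 dF] := @primitive_exists (fun t => expR t * f t).
  by move=> t; apply: continuousM; [exact: continuous_expR|exact: cf].
exists (fun t => expR (- t) * F t); first by rewrite F0 mulr0.
move=> t t1; have dFt := dF _ t1.
have := is_derive_expRM (-1) t; under eq_fun do rewrite mulN1r.
move=> de; apply: (is_derive_eq (is_deriveM de dFt)).
rewrite /GRing.scale/= !mulN1r mulrA -expRD addNr expR0; ring.
Qed.
End linear_ode.

(** * Charges, Lebesgue measure and total variation *)

Section charges.
Context d (T : measurableType d) (R : realType).
Local Open Scope ereal_scope.

(** A nonnegative charge coincides with its positive Jordan part, which has mass one and is left
    unchanged by normalization. *)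
Lemma charge_probability (t0 : T) (nu : {charge set T -> \bar R}) :
  (forall A, measurable A -> 0 <= nu A) -> nu setT = 1 ->
  exists P : probability T R, forall A, measurable A -> nu A = P A.
Proof.
move=> nu0 nu1; have [P [N PN]] := Hahn_decomposition nu.
have [[mP posP] [mN negN] PNT PN0] := PN.
have nuE A : measurable A -> nu A = jordan_pos PN A.
  move=> mA; rewrite jordan_posE cjordan_posE /crestr0 mem_set// /crestr.
  have mAN : measurable (A `&` N) by exact: measurableI.
  rewrite -[in LHS](setIT A) -PNT setIUr chargeU//.
  - rewrite (_ : nu (A `&` N) = 0) ?adde0//.
    by apply/eqP; rewrite eq_le nu0// negN.
  - exact: measurableI.
  - by rewrite setIACA PN0 setI0.
(* The Dirac mass is the fallback of [mnormalize] for mass zero or infinity, ruled out by [e1]. *)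
exists (mnormalize (jordan_pos PN) (dirac t0)) => A mA.
have e1 : jordan_pos PN setT = 1 by rewrite -nuE.
rewrite nuE//= /mnormalize /= e1 ifF/= ?invr1 ?mule1//.
by apply/negbTE; rewrite negb_or onee_neq0.
Qed.

(** On [D] the Jordan parts are, up to sign, the values of [nu] on [D] cut by [P] and by [N]. Each
    has mass at most [c], whence the factor 2. *)
Lemma charge_integral_le (nu : {charge set T -> \bar R}) P N
  (PN : hahn_decomposition nu P N) (D : set T) (c : R) (f : T -> R) :
  measurable D -> measurable_fun D f -> (forall x, D x -> (`|f x| <= 1)%R) ->
  (forall A, measurable A -> `|nu A| <= c%:E) ->
  `|\int[jordan_pos PN]_(x in D) (f x)%:E - \int[jordan_neg PN]_(x in D) (f x)%:E|
    <= (2 * c)%:E.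
Proof.
move=> mD mf f1 nuc.
have [[mP posP] [mN negN] PNT PN0] := PN.
have bound (mu : {measure set T -> \bar R}) : mu D <= c%:E ->
    `|\int[mu]_(x in D) (f x)%:E| <= c%:E.
  move=> muc; apply: (le_trans (le_abse_integral _ _ _)) => //.
    exact/measurable_EFinP.
  apply: (@le_trans _ _ (\int[mu]_(x in D) 1)).
    apply: ge0_le_integral => //.
    by apply: measurableT_comp => //; exact/measurable_EFinP.
  by rewrite integral_cst// mul1e; exact: muc.
apply: (le_trans (lee_abs_sub _ _)).
rewrite mulr_natl mulr2n EFinD; apply: leeD; apply: bound.
  have : jordan_pos PN D <= c%:E; last exact.
  rewrite jordan_posE cjordan_posE /crestr0 mem_set// /crestr.
  by apply: le_trans (lee_abs _) _; apply: nuc; exact: measurableI.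
have : jordan_neg PN D <= c%:E; last exact.
rewrite jordan_negE cjordan_negE /crestr0 mem_set// /crestr.
by apply: le_trans (lee_abs _) _; rewrite abseN; apply: nuc; exact: measurableI.
Qed.

Lemma charge_density (la : {measure set T -> \bar R}) (D : set T) (rho : T -> R)
    (c : R) (nu : {charge set T -> \bar R}) :
  measurable D -> la.-integrable D (EFin \o rho) ->
  exists m : {charge set T -> \bar R}, forall A, measurable A ->
    m A = c%:E * nu A + (\int[la]_(x in A `&` D) rho x)%:E.
Proof.
move=> mD irho.
(* The density is extended by zero outside [D], so that it induces a charge on the whole space. *)
have iD : la.-integrable setT (EFin \o (rho \_ D)%R).
  have := irho; rewrite integrable_mkcond//.
  by rewrite (_ : (EFin \o rho) \_ D = EFin \o (rho \_ D)%R)//;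
    apply/funext => x; rewrite restrict_EFin.
exists (cadd (cscale c nu) (induced_charge iD)) => A mA /=.
rewrite /cadd /cscale /= /induced_charge; congr (_ + _).
rewrite /Rintegral fineK; last first.
  apply: integrable_fin_num; first exact: measurableI.
  by apply: integrableS irho => //; exact: measurableI.
by rewrite integral_mkcondr; apply: eq_integral => x _; rewrite restrict_EFin.
Qed.
End charges.

(** * Measurability on closed sets and the volume of a compact domain *)

Section domain.
Variables (R : realType) (n : nat).
Implicit Types (D A : set 'rV[R]_n) (x : 'rV[R]_n).

Lemma closed_measurable_rV A : closed A -> measurable A.
Proof.
move=> cA; rewrite -(setCK A); apply: measurableC.
by apply: open_measurable_rV; rewrite openC.
Qed.

Lemma within_continuous_measurable_rV A (f : 'rV[R]_n -> R) : measurable A ->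
  {within A, continuous f} -> measurable_fun A f.
Proof.
move=> mA /continuousP cf.
apply: (@measurability _ _ _ R A f _ (RGenOpens.measurableE R)).
move=> _ [_ [a [b ->]] <-].
have oab : open `]a, b[%classic by exact: interval_open.
have /open_subspaceP[V oV VA] : open (f @^-1` `]a, b[%classic : set (subspace A)) by exact: cf.
by rewrite setIC -VA; apply: measurableI => //; exact: open_measurable_rV.
Qed.

Lemma coord_le_norm x i : `|x ord0 i| <= `|x|.
Proof.
rewrite [leRHS]/Num.norm/= mx_normrE.
exact: (le_bigmax_cond _ (fun ij => `|x ij.1 ij.2|) (j := (ord0, i))).
Qed.

Lemma enorm_le_norm x : enorm x <= Num.sqrt n%:R * `|x|.
Proof.
rewrite -[X in _ * X](@ger0_norm _ `|x|)// -sqrtr_sqr -sqrtrM// ler_wsqrtr//.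
apply: (@le_trans _ _ (\sum_(i < n) `|x| ^+ 2)); last first.
  by rewrite sumr_const card_ord mulr_natl.
apply: ler_sum => i _; rewrite -[leLHS]real_normK ?num_real// lerXn2r ?nnegrE//.
exact: coord_le_norm.
Qed.

(** The source of measurability in the action variable for utilities and densities; [Num.sqrt n%:R]
    converts the Euclidean norm into the max norm. *)
Lemma enorm_lipschitz_measurable D (f : 'rV[R]_n -> R) (L : R) : closed D ->
  0 <= L -> (forall x z, D x -> D z -> `|f x - f z| <= L * enorm (x - z)) ->
  measurable_fun D f.
Proof.
move=> cD L0 lipf; apply: within_continuous_measurable_rV; first exact: closed_measurable_rV.
apply: (@lipschitz_within_continuous R _ D f (L * Num.sqrt n%:R)) => [|x z Dx Dz].
  by rewrite mulr_ge0// sqrtr_ge0.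
rewrite -mulrA; apply: le_trans (lipf _ _ Dx Dz) _.
by rewrite ler_wpM2l// enorm_le_norm.
Qed.

Lemma measurable_box (a b : 'rV[R]_n) :
  measurable [set x : 'rV[R]_n | forall i, x ord0 i \in `[a ord0 i, b ord0 i]].
Proof.
rewrite (_ : mkset _ = \bigcap_(i in setT) (fun x : 'rV[R]_n => x ord0 i) @^-1`
    `[a ord0 i, b ord0 i]%classic).
  apply: fin_bigcap_measurable => // i _; rewrite -[X in measurable X]setTI.
  exact: measurable_rV_coord.
by apply/seteqP; split => [x Bx i _|x Bx i]; [exact: Bx|exact: (Bx i)].
Qed.

Lemma compact_domain_closed D : compact_domain D -> closed D.
Proof. by case=> V [? ? ? ? ->]; exact: closed_closure. Qed.

Lemma compact_domain_volume D : compact_domain D ->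
  (0 < lebesgue_rV R n D < +oo)%E.
Proof.
move=> hD; have mD := closed_measurable_rV (compact_domain_closed hD).
have [V [oV [x Vx] bV _ DE]] := hD; apply/andP; split.
  have /nbhs_ballP[e /= e0 xeV] : nbhs x V by apply: open_nbhs_nbhs; split.
  (* Half the radius keeps the closed box inside the open ball. *)
  pose h := e / 2.
  have h0 : 0 < h by rewrite divr_gt0.
  have hh : h + h = e by rewrite -splitr.
  pose a : 'rV[R]_n := \row_i (x ord0 i - h).
  pose b : 'rV[R]_n := \row_i (x ord0 i + h).
  have ab i : a ord0 i <= b ord0 i by rewrite !mxE; lra.
  apply: (@lt_le_trans _ _ (\prod_i (b ord0 i - a ord0 i))%:E).
    by rewrite lte_fin; apply: prodr_gt0 => i _; rewrite !mxE; lra.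
  rewrite -lebesgue_rV_box//; apply: le_measure; rewrite ?inE//.
    exact: measurable_box.
  move=> z hz; rewrite DE; apply: subset_closure; apply: xeV; split => // i j.
  rewrite !ord1; have := hz j; rewrite !mxE in_itv/= /ball/= => /andP[? ?].
  by rewrite ltr_norml; apply/andP; split; lra.
(* Points of [V] have norm at most [|M| + 1]; approximating a point of the closure within distance 1
   costs one more unit. *)
have [M [_ hM]] := bV; pose K := `|M| + 2.
pose a : 'rV[R]_n := \row_i (- K).
pose b : 'rV[R]_n := \row_i K.
have K0 : 0 <= K by rewrite addr_ge0.
have ab i : a ord0 i <= b ord0 i by rewrite !mxE; lra.
apply: (@le_lt_trans _ _ (\prod_i (b ord0 i - a ord0 i))%:E); last by rewrite ltry.
rewrite -lebesgue_rV_box//; apply: le_measure; rewrite ?inE//.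
  exact: measurable_box.
move=> z; rewrite DE => /(_ (ball z 1)) [|w [Vw [_ zw]] i]; first exact: nbhsx_ballx.
have wM : `|w| <= `|M| + 1 by apply: hM => //; rewrite (le_lt_trans (ler_norm M))// ltrDl.
have wi : `|w ord0 i| <= `|w| by exact: coord_le_norm.
have := zw ord0 i; rewrite /ball/= !mxE in_itv/= => h.
have : `|z ord0 i| <= K.
  rewrite -[z ord0 i](subrK (w ord0 i)) (le_trans (ler_normD _ _))// /K.
  by rewrite (_ : `|M| + 2 = 1 + (`|M| + 1)); [apply: lerD; [exact: ltW|exact: le_trans wM]|lra].
by rewrite ler_norml.
Qed.

Lemma normalized_lebesgue_domain D : compact_domain D ->
  normalized_lebesgue D D = 1%E.
Proof.
move=> hD; have /andP[D0 Doo] := compact_domain_volume hD.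
transitivity ((fine (lebesgue_rV R n D))^-1%:E * lebesgue_rV R n D)%E; first by [].
have lf : lebesgue_rV R n D \is a fin_num by rewrite ge0_fin_numE.
by rewrite -[X in (_ * X)%E](fineK lf) -EFinM mulVf// gt_eqF// fine_gt0// D0.
Qed.

End domain.

(** * Total variation of families of probability measures *)

Section families.
Variables (R : realType) (n : nat) (D : set 'rV[R]_n).
Hypothesis mD : measurable D.
Implicit Types (mu nu : measure_family R n).

Lemma tv_norm_le (nu : {charge set 'rV[R]_n -> \bar R}) (c : R) :
  (forall A, measurable A -> (`|nu A| <= c%:E)%E) ->
  (tv_norm D nu <= (2 * c)%:E)%E.
Proof.
move=> nuc; apply: ge_ereal_sup => _ [f [mf f1] <-].
rewrite /charge_integral; case: cid => P exN; case: cid => N PN.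
exact: charge_integral_le.
Qed.

Lemma prob_family_bounds mu y A : prob_family D mu -> measurable A ->
  0 <= fine (mu y A) <= 1.
Proof.
move=> /(_ y)[P [_ PE]] mA; rewrite PE//.
rewrite fine_ge0//= -lee_fin fineK ?probability_le1//.
exact: fin_num_measure.
Qed.

Lemma prob_family_setC mu y A : prob_family D mu -> measurable A ->
  A `&` D = set0 -> mu y A = 0%E.
Proof.
move=> /(_ y)[P [PD PE]] mA AD; rewrite PE//.
apply/eqP; rewrite -measure_le0; apply: (@le_trans _ _ (P (~` D))).
  apply: le_measure; rewrite ?inE//; first exact: measurableC.
  by move=> x Ax Dx; have : set0 x by rewrite -AD.
by rewrite probability_setC// PD subee.
Qed.

Lemma prob_family_setI mu y A : prob_family D mu -> measurable A ->
  mu y A = mu y (A `&` D).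
Proof.
move=> hmu mA.
have mAD : measurable (A `\` D) by exact: measurableD.
rewrite (chargeDI (mu y) mA mD) (prob_family_setC y hmu mAD) ?add0e//.
by rewrite setDE -setIA setICl setI0.
Qed.

(** Setwise values at most 1 give total variation at most 2, the radius of [signed_family2], so the
    assumptions on the utility apply. *)
Lemma prob_family_signed mu : prob_family D mu -> signed_family2 D mu.
Proof.
move=> hmu.
have tv2 : (family_tv_norm D mu <= 2%:E)%E.
  apply: ge_ereal_sup => _ [y _ <-]; rewrite -[X in X%:E]mulr1.
  apply: tv_norm_le => A mA.
  have /andP[h0 h1] := prob_family_bounds y hmu mA.
  by rewrite -(fineK (fin_num_measure (mu y) _ mA)) lee_fin ger0_norm.
split=> //; split=> [y A mA AD|]; first exact: prob_family_setC.
by rewrite (le_lt_trans tv2)// ltry.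
Qed.

(** Both families vanish outside [D], so Borel subsets of [D] decide. This is how setwise estimates
    reach the Lipschitz assumption on the utility. *)
Lemma family_tv_norm_sub_le mu nu (c : R) : prob_family D mu ->
  prob_family D nu ->
  (forall y A, measurable A -> A `<=` D ->
    `|fine (mu y A) - fine (nu y A)| <= c) ->
  (family_tv_norm D (family_sub mu nu) <= (2 * c)%:E)%E.
Proof.
move=> hmu hnu h; apply: ge_ereal_sup => _ [y _ <-].
apply: tv_norm_le => A mA.
have mAD : measurable (A `&` D) by exact: measurableI.
rewrite (_ : family_sub mu nu y A = (mu y A - nu y A)%E)//.
rewrite (prob_family_setI y hmu mA) (prob_family_setI y hnu mA).
rewrite -(fineK (fin_num_measure (mu y) _ mAD)) -(fineK (fin_num_measure (nu y) _ mAD)).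
by rewrite -EFinN -EFinD lee_fin; apply: h => //; exact: subIsetr.
Qed.

End families.

(** * Families driven by a density *)

Lemma within_continuousB (R : realType) (A : set R) (f g : R -> R) :
  {within A, continuous f} -> {within A, continuous g} ->
  {within A, continuous (fun t => f t - g t)}.
Proof. by move=> cf cg x; exact: (@continuousB _ R^o _ _ _ x (cf x) (cg x)). Qed.

Lemma derivative_lipschitz (R : realType) (g dg : R -> R) (K : R) :
  {within `[0, +oo[, continuous g} ->
  (forall t : R, 0 < t -> is_derive t 1 g (dg t)) ->
  (forall t : R, 0 < t -> `|dg t| <= K) ->
  forall s t : R, 0 <= s -> 0 <= t -> `|g s - g t| <= K * `|s - t|.
Proof.
move=> cg dgE dgK s t; wlog st : s t / s < t.
  move=> H s0 t0; have [st|ts|->] := ltgtP s t; first exact: H.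
    by rewrite distrC (distrC s); exact: H.
  by rewrite !subrr normr0 mulr0.
move=> s0 t0; rewrite distrC (distrC s).
have [||c cst ->] := @MVT R g dg s t st.
- by move=> x; rewrite in_itv/= => /andP[sx _]; apply: dgE; exact: le_lt_trans sx.
- apply: continuous_subspaceW cg => x /=; rewrite !in_itv/= andbT => /andP[sx _].
  exact: le_trans sx.
rewrite normrM ler_wpM2r//; apply: dgK.
by move: cst; rewrite in_itv/= => /andP[sc _]; exact: le_lt_trans sc.
Qed.

Section forced_density.
Variables (R : realType) (n : nat) (D : set 'rV[R]_n).
Variable la : {measure set 'rV[R]_n -> \bar R}.
Hypotheses (cD : closed D) (laD : la D = 1%E).
Variables (l : R -> 'rV[R]_n -> R) (C L M : R).
Hypotheses (C0 : 0 <= C) (L0 : 0 <= L) (M0 : 0 <= M).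
Hypothesis l_bounds : forall (t : R) z, 0 <= t -> D z -> 0 <= l t z <= C.
Hypothesis l_space : forall (t : R) z w, 0 <= t -> D z -> D w ->
  `|l t z - l t w| <= L * enorm (z - w).
Hypothesis l_time : forall (s t : R) z, 0 <= s -> 0 <= t -> D z ->
  `|l s z - l t z| <= M * `|s - t|.

Let mD : measurable D := closed_measurable_rV cD.

(** The equation is solved separately at each point [z]. The scalar comparison with rate 0 transfers
    the bounds and the spatial Lipschitz constant from [l] to the solution; the latter gives
    measurability, and the bound [C] on the time derivative permits differentiation under the
    integral. *)
Lemma forced_density_exists : exists rho : R -> 'rV[R]_n -> R,
  (forall t : R, 0 <= t -> measurable_fun D (rho t) /\
    forall z, D z -> 0 <= rho t z <= C) /\
  forall A, measurable A -> A `<=` D ->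
    [/\ \int[la]_(z in A) rho 0 z = 0,
        {within `[0, +oo[, continuous (fun t : R => \int[la]_(z in A) rho t z)} &
        forall t : R, 0 < t ->
          is_derive t 1 (fun t : R => \int[la]_(z in A) rho t z)
            (\int[la]_(z in A) l t z - \int[la]_(z in A) rho t z)].
Proof.
(* The forcing is controlled at nonnegative times only; evaluating it at [|t|] makes it Lipschitz on
   the whole line. *)
have /choice[r rE] (z : 'rV[R]_n) : exists g : R -> R, D z -> g 0 = 0 /\
    forall t : R, -1 < t -> is_derive t 1 g (l `|t| z - g t).
  have [Dz|nDz] := pselect (D z); last by exists (cst 0).
  have [|g g0 dg] := @linear_ode_exists R (fun t => l `|t| z).
    apply/continuous_subspace_setT.
    apply: (@lipschitz_within_continuous R _ setT _ M) => // x y _ _.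
    apply: le_trans (l_time _ _ Dz) _ => //.
    by rewrite ler_wpM2l// ler_dist_dist.
  by exists g.
have cr z : D z -> {within `[0, +oo[, continuous (r z)}.
  move=> Dz; apply: derivable_within_continuous => t; rewrite in_itv/= andbT => t0.
  have t1 : -1 < t by apply: lt_le_trans t0; rewrite ltrN10.
  by have [_ dg] := rE _ Dz; have [] := dg _ t1.
have dr z (t : R) : D z -> 0 < t -> is_derive t 1 (r z) (l t z - r z t).
  move=> Dz t0; have [_ /(_ t)] := rE _ Dz; rewrite gtr0_norm//; apply.
  by apply: lt_trans t0; rewrite ltrN10.
have r0 z : D z -> r z 0 = 0 by move=> /rE[].
have r_bounds (t : R) z : 0 <= t -> D z -> 0 <= r z t <= C.
  move=> t0 Dz; apply/andP; split.
    apply: (linear_ode_ge0 (cr _ Dz) (r0 _ Dz) (r := fun t => l t z)) => // s s0.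
      exact: dr.
    by have /andP[] := l_bounds (ltW s0) Dz.
  have := linear_ode_norm C0 (lexx 0) (cr _ Dz) (r0 _ Dz) (r := fun t => l t z) _ _ t0.
  rewrite mul0r expR0 mulr1 add0r divr1 => H.
  apply: le_trans (ler_norm _) (H _ _) => s s0; first exact: dr.
  have /andP[? ?] := l_bounds (ltW s0) Dz.
  by rewrite mul0r expR0 mulr1 ger0_norm.
have r_space (t : R) z w : 0 <= t -> D z -> D w -> `|r z t - r w t| <= L * enorm (z - w).
  move=> t0 Dz Dw.
  have E0 : 0 <= L * enorm (z - w) by rewrite mulr_ge0// sqrtr_ge0.
  have := @linear_ode_norm R (fun t => r z t - r w t)
    (fun t => l t z - l t w) _ _ E0 (lexx 0) _ _ _ _ t t0.
  rewrite mul0r expR0 mulr1 add0r divr1; apply.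
  - by apply: within_continuousB; exact: cr.
  - by rewrite !r0// subrr.
  - move=> s s0; apply: (is_derive_eq (is_deriveB (dr _ _ Dz s0) (dr _ _ Dw s0))).
    by ring.
  - by move=> s s0; rewrite mul0r expR0 mulr1; exact: l_space (ltW s0) Dz Dw.
have rm (t : R) : 0 <= t -> bounded_measurable D (r^~ t).
  move=> t0; split.
    by apply: (enorm_lipschitz_measurable cD L0) => z w Dz Dw; exact: r_space.
  exists C => z Dz; have /andP[? ?] := r_bounds _ _ t0 Dz; by rewrite ger0_norm.
have lm (t : R) : 0 <= t -> bounded_measurable D (l t).
  move=> t0; split.
    by apply: (enorm_lipschitz_measurable cD L0) => z w Dz Dw; exact: l_space.
  exists C => z Dz; have /andP[? ?] := l_bounds t0 Dz; by rewrite ger0_norm.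
have dr_norm (t : R) z : D z -> 0 < t -> `|l t z - r z t| <= C.
  move=> Dz t0; have /andP[? ?] := r_bounds _ _ (ltW t0) Dz.
  have /andP[? ?] := l_bounds (ltW t0) Dz.
  by rewrite ler_norml; apply/andP; split; lra.
have r_time (s t : R) z : D z -> 0 <= s -> 0 <= t -> `|r z s - r z t| <= C * `|s - t|.
  move=> Dz; apply: (derivative_lipschitz (cr _ Dz) (dg := fun t => l t z - r z t)).
    by move=> x x0; exact: dr.
  by move=> x x0; exact: dr_norm.
exists (fun t z => r z t); split.
  by move=> t t0; split; [case: (rm _ t0)|move=> z Dz; exact: r_bounds].
move=> A mA AD; split.
- transitivity (\int[la]_(z in A) (0 : R)); last by rewrite Rintegral_cst// mul0r.
  by apply: eq_Rintegral => z; rewrite inE => /AD/r0.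
- apply: (lipschitz_within_continuous C0) => s t; rewrite /= !in_itv/= !andbT => s0 t0.
  apply: (normr_RintegralB_le mD laD mA AD (rm _ s0) (rm _ t0)).
    by rewrite mulr_ge0.
  by move=> z Dz; exact: r_time.
- move=> t t0.
  (* An open interval of positive times around [t], on which the derivative is dominated by the
     constant [C]. *)
  have It : `]0, t + 1[%classic t by rewrite /= in_itv/= t0/= ltrDl ltr01.
  have intr (x : R) : `]0, t + 1[%classic x -> la.-integrable A (EFin \o (r^~ x)).
    rewrite /= in_itv/= => /andP[x0 _].
    exact: (bounded_measurable_integrable mD laD mA AD (rm _ (ltW x0))).
  have d1 (x : R) z : `]0, t + 1[%classic x -> A z -> is_derive x 1 (r z) (l x z - r z x).
    by rewrite /= in_itv/= => /andP[x0 _] /AD Dz; exact: dr.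
  have d1E (x : R) z : `]0, t + 1[%classic x -> A z ->
      partial1of2 (fun t z => r z t) x z = l x z - r z x.
    by move=> Ix Az; rewrite partial1of2E; have [_ <-] := d1 _ _ Ix Az.
  have derf (x : R) z : `]0, t + 1[%classic x -> A z -> derivable (r z) x 1.
    by move=> Ix Az; have [] := d1 _ _ Ix Az.
  have iC : la.-integrable A (EFin \o cst C).
    exact: (bounded_measurable_integrable mD laD mA AD (bounded_measurable_cst _ _)).
  have bd (x : R) z : `]0, t + 1[%classic x -> A z ->
      `|partial1of2 (fun t z => r z t) x z| <= cst C z.
    move=> Ix Az; rewrite d1E//; move: Ix; rewrite /= in_itv/= => /andP[x0 _].
    by apply: dr_norm => //; exact: AD.
  have der := @derivable_under_integral R _ _ la (fun t z => r z t) A mA t 0 (t + 1) It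
    intr derf (cst C) (fun=> C0) iC bd.
  have derE := @differentiation_under_integral R _ _ la (fun t z => r z t) A mA t 0 (t + 1) It
    intr derf (cst C) (fun=> C0) iC bd.
  apply: DeriveDef => //; rewrite -derive1E derE.
  rewrite -RintegralB//; last 2 first.
  - exact: (bounded_measurable_integrable mD laD mA AD (lm _ (ltW t0))).
  - exact: (bounded_measurable_integrable mD laD mA AD (rm _ (ltW t0))).
  by apply: eq_Rintegral => z; rewrite inE => Az; exact: d1E.
Qed.

End forced_density.

(** * Existence, time regularity and stability of families driven by a density *)

Section driven.
Variables (R : realType) (n : nat) (D : set 'rV[R]_n).
Variable la : {measure set 'rV[R]_n -> \bar R}.
Hypotheses (cD : closed D) (laD : la D = 1%E).
Variable mu0 : measure_family R n.
Hypothesis mu0_prob : prob_family D mu0.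
Let mD : measurable D := closed_measurable_rV cD.

(** The class in which the iteration lives. The spatial bound provides measurability, the time bound
    a continuous forcing, and unit mass keeps the driven family a probability. *)
Definition admissible (C L M : R) (l : R -> {i01 R} -> 'rV[R]_n -> R) :=
  [/\ forall (t : R) y z, 0 <= t -> D z -> 0 <= l t y z <= C,
      forall (t : R) y z w, 0 <= t -> D z -> D w ->
        `|l t y z - l t y w| <= L * enorm (z - w),
      forall (s t : R) y z, 0 <= s -> 0 <= t -> D z ->
        `|l s y z - l t y z| <= M * `|s - t| &
      forall (t : R) y, 0 <= t -> \int[la]_(z in D) l t y z = 1].

(** Linear counterpart of [logit_solution], recovered when [l] is the logit response to [m]
    itself. *)
Definition driven_by (l : R -> {i01 R} -> 'rV[R]_n -> R)
    (m : R -> measure_family R n) :=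
  forall A y, measurable A -> A `<=` D ->
    [/\ m 0 y A = mu0 y A,
        {within `[0, +oo[, continuous (fun t : R => fine (m t y A))} &
        forall t : R, 0 < t -> is_derive t 1 (fun s : R => fine (m s y A))
          (\int[la]_(z in A) l t y z - fine (m t y A))].

Lemma admissible_bounded_measurable C L M l (t : R) y : 0 <= L ->
  admissible C L M l -> 0 <= t -> bounded_measurable D (l t y).
Proof.
move=> L0 [lC lL _ _] t0; split.
  by apply: (enorm_lipschitz_measurable cD L0) => z w Dz Dw; exact: lL.
by exists C => z Dz; have /andP[? ?] := lC t y z t0 Dz; rewrite ger0_norm.
Qed.

Lemma is_derive_gt0_eq (f g : R -> R) (t df : R) : 0 < t ->
  (forall s : R, 0 <= s -> f s = g s) -> is_derive t 1 g df -> is_derive t 1 f df.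
Proof.
move=> t0 fg dg.
have nfg : {near t, f =1 g}.
  by near=> s; apply: fg; apply: ltW; near: s; exact: lt_nbhsr.
apply: near_eq_is_derive dg.
by apply: filterS nfg => s ->.
Unshelve. all: by end_near. Qed.

(** Variation of constants: the family is [expR (- t)] times [mu0] plus the measure with density
    [rho y t]. *)
Lemma driven_by_exists C L M l : 0 <= C -> 0 <= L -> 0 <= M ->
  admissible C L M l ->
  exists2 m, driven_by l m & forall t : R, 0 <= t -> prob_family D (m t).
Proof.
move=> C0 L0 M0 [lC lL lM l1].
have /choice[rho rhoP] y := forced_density_exists cD laD C0 L0 M0
  (fun t z => lC t y z) (fun t z w => lL t y z w) (fun s t z => lM s t y z).
have bm y (t : R) : 0 <= t -> bounded_measurable D (rho y t).
  move=> t0; have [/(_ _ t0)[mr rC] _] := rhoP y; split=> //.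
  by exists C => z Dz; have /andP[? ?] := rC _ Dz; rewrite ger0_norm.
have /choice[ch chE] (p : R * {i01 R}) : exists nu : {charge set 'rV[R]_n -> \bar R},
    0 <= p.1 -> forall A, measurable A ->
    nu A = ((expR (-1 * p.1))%:E * mu0 p.2 A +
            (\int[la]_(z in A `&` D) rho p.2 p.1 z)%:E)%E.
  have [p0|p0] := leP 0 p.1; last by exists (mu0 p.2).
  have [|nu nuE] := @charge_density _ _ R la D (rho p.2 p.1) (expR (-1 * p.1)) (mu0 p.2) mD.
    exact: (bounded_measurable_integrable mD laD mD _ (bm _ _ p0)).
  by exists nu.
pose m (t : R) y := ch (t, y).
have mE (t : R) y A : 0 <= t -> measurable A -> A `<=` D ->
    fine (m t y A) = expR (-1 * t) * fine (mu0 y A) + \int[la]_(z in A) rho y t z.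
  move=> t0 mA AD; rewrite /m (chE (t, y) t0 A mA)/= setIidl//.
  by rewrite -{1}(fineK (fin_num_measure (mu0 y) _ mA)).
(* Both sides solve [g' = 1 - g] from 0, so their difference is driven by zero and vanishes. The
   density thus supplies exactly the mass lost by [mu0]. *)
have mass y (t : R) : 0 <= t -> \int[la]_(z in D) rho y t z = 1 - expR (-1 * t).
  move=> t0; have [_ /(_ D mD)[//|r0 cr dr]] := rhoP y.
  apply/eqP; rewrite -subr_eq0 -normr_le0.
  have := @linear_ode_norm R (fun t => \int[la]_(z in D) rho y t z - (1 - expR (-1 * t)))
    (cst 0) 0 0 (lexx 0) (lexx 0) _ _ _ _ t t0.
  rewrite !mul0r; apply.
  - apply: within_continuousB => //; apply: continuous_subspaceT => x.
    apply: differentiable_continuous; apply/derivable1_diffP.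
    by have [] := is_deriveB (is_derive_cst (1 : R) x 1) (is_derive_expRM (-1) x).
  - by rewrite r0 mulr0 expR0 subrr subrr.
  - move=> s s0; apply: (is_derive_eq (is_deriveB (dr _ s0)
      (is_deriveB (is_derive_cst (1 : R) s 1) (is_derive_expRM (-1) s)))).
    by rewrite l1 ?(ltW s0)//=; move: (expR _) (Rintegral _ _ _) => ? ?; ring.
  - by move=> s s0; rewrite normr0 !mul0r.
exists m.
  move=> A y mA AD; have [_ /(_ A mA AD)[r0 cr dr]] := rhoP y.
  split.
  - rewrite -(fineK (fin_num_measure (mu0 y) _ mA)) -[LHS]fineK ?fin_num_measure//.
    by rewrite mE// r0 mulr0 expR0 mul1r addr0.
  - pose g (t : R) := \int[la]_(z in A) rho y t z - - (fine (mu0 y A) * expR (-1 * t)).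
    apply: (@subspace_eq_continuous _ _ _ g).
      move=> t /set_mem/=; rewrite in_itv/= andbT => t0.
      by apply: etrans (esym (mE t y A t0 mA AD)); rewrite /g opprK addrC mulrC.
    apply: within_continuousB => //; apply: continuous_subspaceT => x.
    apply: differentiable_continuous; apply/derivable1_diffP.
    by have [] := is_deriveN (is_deriveZ (fine (mu0 y A)) (is_derive_expRM (-1) x)).
  - move=> t t0; apply: (is_derive_gt0_eq t0 (fun s s0 => mE s y A s0 mA AD)).
    under eq_fun do rewrite mulrC.
    apply: (is_derive_eq (is_deriveD (is_deriveZ (fine (mu0 y A))
      (is_derive_expRM (-1) t)) (dr _ t0))).
    rewrite (mE _ _ _ (ltW t0))// /GRing.scale/=.
    by move: (expR _) (Rintegral _ _ _) (Rintegral _ _ _) (fine _) => ? ? ? ?; ring.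
move=> t t0 y.
have mD1 : m t y D = 1%E.
  rewrite -[LHS]fineK ?fin_num_measure// mE// mass//.
  have [P [PD PE]] := mu0_prob y; rewrite PE// PD /=; congr (_%:E); ring.
have [||P PE] := charge_probability (0 : 'rV[R]_n) (nu := m t y).
- move=> A mA; rewrite /m (chE (t, y) t0 A mA)/=; have [P [_ PE]] := mu0_prob y.
  rewrite PE// adde_ge0// ?mule_ge0// lee_fin ?expR_ge0//.
  apply: Rintegral_ge0 => z [_ Dz].
  by have [/(_ _ t0)[_ /(_ _ Dz)/andP[]]] := rhoP y.
- rewrite /m (chE (t, y) t0 _ measurableT)/= setTI mass//.
  have [P [_ PE]] := mu0_prob y; rewrite PE// probability_setT mule1 -EFinD.
  by congr (_%:E); ring.
by exists P; split=> //; rewrite -PE.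
Qed.

(** The time derivative is at most [C], from the density, plus 1, from the mass of a probability. *)
Lemma driven_by_time C l m (s t : R) y A : 0 <= C ->
  (forall (t : R) y, 0 <= t -> bounded_measurable D (l t y)) ->
  (forall (t : R) y z, 0 <= t -> D z -> `|l t y z| <= C) -> driven_by l m ->
  (forall t : R, 0 <= t -> prob_family D (m t)) ->
  0 <= s -> 0 <= t -> measurable A -> A `<=` D ->
  `|fine (m s y A) - fine (m t y A)| <= (C + 1) * `|s - t|.
Proof.
move=> C0 bl lC dm pm s0 t0 mA AD; have [_ cm dmt] := dm A y mA AD.
apply: (derivative_lipschitz cm dmt) => // x x0.
rewrite (le_trans (ler_normB _ _))//; apply: lerD.
  apply: (normr_Rintegral_le mD laD mA AD (bl _ _ (ltW x0)) C0) => z Dz.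
  by apply: lC => //; exact: ltW.
by have /andP[? ?] := prob_family_bounds y (pm _ (ltW x0)) mA; rewrite ger0_norm.
Qed.

(** Both families start at [mu0], so their difference on [A] solves the scalar equation from 0. *)
Lemma driven_by_dist l1 l2 m1 m2 (a c : R) : 0 <= a -> 0 <= c ->
  (forall (t : R) y, 0 <= t -> bounded_measurable D (l1 t y)) ->
  (forall (t : R) y, 0 <= t -> bounded_measurable D (l2 t y)) ->
  driven_by l1 m1 -> driven_by l2 m2 ->
  (forall (t : R) y z, 0 <= t -> D z ->
    `|l1 t y z - l2 t y z| <= a * expR (c * t)) ->
  forall (t : R) y A, 0 <= t -> measurable A -> A `<=` D ->
  `|fine (m1 t y A) - fine (m2 t y A)| <= a / (c + 1) * expR (c * t).
Proof.
move=> a0 c0 b1 b2 d1 d2 l12 t y A t0 mA AD.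
have [i1 c1 e1] := d1 A y mA AD; have [i2 c2 e2] := d2 A y mA AD.
apply: (@linear_ode_norm R (fun t => fine (m1 t y A) - fine (m2 t y A))
  (fun t => \int[la]_(z in A) l1 t y z - \int[la]_(z in A) l2 t y z)) => //.
- exact: within_continuousB.
- by rewrite i1 i2 subrr.
- move=> s s0; apply: (is_derive_eq (is_deriveB (e1 _ s0) (e2 _ s0))).
  by rewrite !opprD !opprK addrACA.
- move=> s s0; apply: (normr_RintegralB_le mD laD mA AD (b1 _ _ (ltW s0)) (b2 _ _ (ltW s0))).
    by rewrite mulr_ge0// expR_ge0.
  by move=> z Dz; apply: l12 => //; exact: ltW.
Qed.

End driven.

(** * The fixed point *)

Lemma le_geometric (R : realType) (x y a : R) :
  (forall k : nat, x <= y + a / 2 ^+ k) -> x <= y.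
Proof.
move=> h; apply/ler_addgt0Pr => e e0.
have := @cvg_geometric R (`|a|) 2^-1; rewrite ger0_norm// => /(_ _)/wrap[].
  by rewrite invf_lt1// ltr1n.
move=> /cvgrPdist_le/(_ _ e0)[k _ /(_ k (leqnn k))]; rewrite /geometric/= sub0r normrN => ka.
apply: le_trans (h k) _; rewrite lerD2l (le_trans _ ka)//.
by rewrite normrM normr_id exprVn (le_trans (ler_norm _))// normrM normfV.
Qed.

(* The limit is the supremum of the nondecreasing minorants [u k - 2 a / 2^k]. *)
Lemma geometric_cauchy_limit (R : realType) (u : nat -> R) (a : R) :
  (forall k, `|u k.+1 - u k| <= a / 2 ^+ k) ->
  exists x, forall k, `|x - u k| <= 2 * a / 2 ^+ k.
Proof.
move=> hu; pose v k := u k - 2 * a / 2 ^+ k; pose w k := u k + 2 * a / 2 ^+ k.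
have half k : 2 * a / 2 ^+ k.+1 = a / 2 ^+ k.
  by rewrite exprS invfM mulrACA divff// mul1r.
have dbl k : 2 * a / 2 ^+ k = a / 2 ^+ k + a / 2 ^+ k by rewrite -mulrA mulr_natl mulr2n.
have a0 : 0 <= a by have := le_trans (normr_ge0 _) (hu 0%N); rewrite expr0 divr1.
have vS : {homo v : i j / (i <= j)%N >-> i <= j}.
  apply: homo_leq => // [x y z|k]; first exact: le_trans.
  have := hu k; rewrite ler_norml /v half dbl => /andP[h1 h2]; lra.
have wS : {homo w : i j / (i <= j)%N >-> j <= i}.
  apply: (@homo_leq _ w (fun x y => y <= x)) => // [x y z xy yz|k]; first exact: le_trans yz xy.
  have := hu k; rewrite ler_norml /w half dbl => /andP[h1 h2]; lra.
have vw i j : v i <= w j.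
  apply: (@le_trans _ _ (v (maxn i j))); first by apply: vS; exact: leq_maxl.
  apply: (@le_trans _ _ (w (maxn i j))); last by apply: wS; exact: leq_maxr.
  have : 0 <= 2 * a / 2 ^+ maxn i j by rewrite divr_ge0// mulr_ge0.
  by rewrite /v /w; lra.
have vub j : ubound (range v) (w j) by move=> _ [i _ <-]; exact: vw.
have hs : has_sup (range v) by split; [exists (v 0%N), 0%N|exists (w 0%N)].
exists (sup (range v)) => k; rewrite ler_distl; apply/andP; split.
  by apply: ub_le_sup; [case: hs|exists k].
by apply: ge_sup; [case: hs|exact: vub].
Qed.

(** * The logit response to a family of probability measures *)

Section logit_response.
Variables (R : realType) (n : nat) (D : set 'rV[R]_n).
Variables (U : utility R n) (Ubar LD LM LG cU DU eps omega : R).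
Hypotheses (D_domain : compact_domain D) (Ubar_gt0 : 0 < Ubar)
  (LD_gt0 : 0 < LD) (LM_gt0 : 0 < LM).
Hypothesis U_assumptions : utility_assumptions D U Ubar LD LM LG cU DU.
Hypotheses (eps_gt0 : 0 < eps) (omega_gt0 : 0 < omega).
Local Notation la := (normalized_lebesgue D).
Let cD : closed D := compact_domain_closed D_domain.
Let mD : measurable D := closed_measurable_rV cD.
Let laD : la D = 1%E := normalized_lebesgue_domain D_domain.
Let b := eps / omega.
Let C := expR (b * Ubar).
Let C0 : 0 <= C := expR_ge0 _.
Let b0 : 0 <= b := divr_ge0 (ltW eps_gt0) (ltW omega_gt0).
Let Ubar0 : 0 <= Ubar := ltW Ubar_gt0.

Definition response (mu : measure_family R n) (y : {i01 R}) (z : 'rV[R]_n) : R :=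
  logit D U (inverse_temperature D U eps omega y mu) z y mu.

Lemma responseE mu y :
  response mu y = logit_choice la D eps omega (fun z => U z y mu).
Proof. by []. Qed.

Lemma utility_fun_prob mu y : prob_family D mu ->
  utility_fun D Ubar (fun z => U z y mu).
Proof.
move=> /(prob_family_signed mD) hmu; split.
  apply: (enorm_lipschitz_measurable cD (ltW LD_gt0)) => x z Dx Dz.
  exact: (utility_lipschitz_action U_assumptions).
by move=> x Dx; exact: (utility_bounds U_assumptions).
Qed.

Lemma response_bounds mu y z : prob_family D mu -> D z ->
  0 <= response mu y z <= C.
Proof.
by move=> /(utility_fun_prob y) hu Dz; rewrite responseE; exact: logit_choice_bounds.
Qed.

Lemma response_space mu y z w : prob_family D mu -> D z -> D w ->
  `|response mu y z - response mu y w| <= C * b * LD * enorm (z - w).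
Proof.
move=> hmu Dz Dw; rewrite responseE.
apply: (le_trans (logit_choice_lipschitz_space mD laD Ubar0 eps_gt0 omega_gt0
  (utility_fun_prob y hmu) Dz Dw)).
rewrite -[leRHS]mulrA; apply: ler_wpM2l; first by rewrite mulr_ge0.
exact: (utility_lipschitz_action U_assumptions y Dz Dw (prob_family_signed mD hmu)).
Qed.

(** The factor [LM * 2] is the Lipschitz constant of the utility times the passage from setwise
    differences to total variation. *)
Lemma response_lipschitz : exists2 K, 0 <= K & forall mu nu c,
  prob_family D mu -> prob_family D nu -> 0 <= c ->
  (forall y A, measurable A -> A `<=` D ->
    `|fine (mu y A) - fine (nu y A)| <= c) ->
  forall y z, D z -> `|response mu y z - response nu y z| <= K * c.
Proof.
have [K K0 hK] := logit_choice_lipschitz mD laD Ubar0 eps_gt0 omega_gt0.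
exists (K * (LM * 2)); first by rewrite !mulr_ge0// ltW.
move=> mu nu c hmu hnu c0 munu y z Dz; rewrite !responseE -!mulrA.
apply: hK => //; [exact: utility_fun_prob..|by rewrite !mulr_ge0// ltW|].
move=> x Dx; rewrite -lee_fin.
apply: (le_trans (utility_lipschitz_measure U_assumptions y Dx
  (prob_family_signed mD hmu) (prob_family_signed mD hnu))).
rewrite EFinM; apply: lee_wpmul2l; first by rewrite lee_fin ltW.
exact: family_tv_norm_sub_le.
Qed.

Lemma bounded_measurable_response mu y : prob_family D mu ->
  bounded_measurable D (response mu y).
Proof.
by move=> /(utility_fun_prob y) hu; rewrite responseE; exact: bounded_measurable_logit_choice hu.
Qed.

Lemma Rintegral_response mu y : prob_family D mu ->
  \int[la]_(z in D) response mu y z = 1.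
Proof. by move=> /(utility_fun_prob y) hu; rewrite responseE; exact: Rintegral_logit_choice hu. Qed.

End logit_response. 

(** * Existence and uniqueness by iteration of the response map *)

Theorem proposition1 (R : realType) (n : nat) (D : set 'rV[R]_n)
    (U : utility R n) (Ubar LD LM LG cU DU eps omega : R)
    (D_domain : compact_domain D) (D_diameter : ediameter D = 1%E)
    (Ubar_gt0 : 0 < Ubar) (LD_gt0 : 0 < LD) (LM_gt0 : 0 < LM)
    (LG_gt0 : 0 < LG) (cU_gt0 : 0 < cU) (DU_gt0 : 0 < DU)
    (U_assumptions : utility_assumptions D U Ubar LD LM LG cU DU)
    (eps_gt0 : 0 < eps) (omega_gt0 : 0 < omega)
    (mu0 : measure_family R n) (mu0_prob : prob_family D mu0) :
  exists mu : R -> measure_family R n,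
    [/\ logit_solution D U eps omega mu0 mu,
        forall t, 0 <= t -> prob_family D (mu t) &
        forall nu : R -> measure_family R n,
          logit_solution D U eps omega mu0 nu ->
          (forall t, 0 <= t -> prob_family D (nu t)) ->
          forall t y A, 0 <= t -> measurable A -> A `<=` D ->
            nu t y A = mu t y A].
Proof.
pose la := normalized_lebesgue D.
have cD := compact_domain_closed D_domain.
have mD := closed_measurable_rV cD.
have laD : la D = 1%E := normalized_lebesgue_domain D_domain.
pose rsp := response D U eps omega.
have [K K0 rspK] := response_lipschitz D_domain Ubar_gt0 LD_gt0 LM_gt0
  U_assumptions eps_gt0 omega_gt0.
pose C := expR (eps / omega * Ubar).
have C0 : 0 <= C by exact: expR_ge0.
have C1 : 1 <= C by rewrite -expR0 ler_expR mulr_ge0 ?divr_ge0 ?ltW.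
pose L := C * (eps / omega) * LD.
have L0 : 0 <= L.
  by rewrite mulr_ge0 ?(ltW LD_gt0)// mulr_ge0// divr_ge0// ltW.
(* A driven family moves at speed at most [C + 1], and its response at most [K] times as fast. *)
pose M := K * (C + 1).
have M0 : 0 <= M by rewrite mulr_ge0// addr_ge0.
pose adm := admissible D la C L M.
pose prob (m : R -> measure_family R n) := forall t : R, 0 <= t -> prob_family D (m t).
pose resp (m : R -> measure_family R n) (t : R) := rsp (m t).
pose driven := driven_by D la mu0.
have adm_bm l (t : R) y : adm l -> 0 <= t -> bounded_measurable D (l t y).
  by move=> al; exact: (admissible_bounded_measurable cD y L0 al).
have adm_gap l l' (t : R) y z : adm l -> adm l' -> 0 <= t -> D z ->
    `|l t y z - l' t y z| <= C.
  move=> [lC _ _ _] [lC' _ _ _] t0 Dz.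
  have /andP[? ?] := lC t y z t0 Dz; have /andP[? ?] := lC' t y z t0 Dz.
  by rewrite ler_norml; apply/andP; split; lra.
have resp_C m (t : R) y z : prob m -> 0 <= t -> D z -> 0 <= resp m t y z <= C.
  move=> pm t0; apply: (response_bounds D_domain Ubar_gt0 LD_gt0 U_assumptions eps_gt0 omega_gt0).
  exact: pm.
have resp_bm m (t : R) y : prob m -> 0 <= t -> bounded_measurable D (resp m t y).
  move=> pm t0.
  apply: (bounded_measurable_response eps omega D_domain LD_gt0 U_assumptions y
    (pm _ t0)).
(* The driving density enters only through measurability and the bound [C], so this applies to the
   response along an arbitrary solution too. *)
have resp_adm l m : (forall (t : R) y, 0 <= t -> bounded_measurable D (l t y)) ->
    (forall (t : R) y z, 0 <= t -> D z -> 0 <= l t y z <= C) ->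
    driven l m -> prob m -> adm (resp m).
  move=> bl lC dm pm; split=> [t y z t0 Dz|t y z w t0 Dz Dw|s t y z s0 t0 Dz|t y t0].
  - exact: resp_C.
  - exact: (response_space D_domain Ubar_gt0 LD_gt0 U_assumptions eps_gt0 omega_gt0 _ (pm _ t0)).
  - rewrite /M -mulrA; apply: rspK => //; [exact: pm|exact: pm| |].
      by rewrite mulr_ge0// addr_ge0.
    move=> y' A mA AD.
    apply: (driven_by_time cD laD y' C0 bl _ dm pm s0 t0 mA AD) => x u v x0 Dv.
    by have /andP[? ?] := lC x u v x0 Dv; rewrite ger0_norm.
  - exact: (Rintegral_response D_domain Ubar_gt0 LD_gt0 U_assumptions eps_gt0
      omega_gt0 _ (pm _ t0)).
(* With this weight, [K / (c + 1)] is at most one half. *)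
pose c := 2 * K.
have c0 : 0 <= c by rewrite mulr_ge0.
have contraction l1 l2 m1 m2 a : adm l1 -> adm l2 -> driven l1 m1 -> driven l2 m2 ->
    prob m1 -> prob m2 -> 0 <= a ->
    (forall (t : R) y z, 0 <= t -> D z -> `|l1 t y z - l2 t y z| <= a * expR (c * t)) ->
    forall (t : R) y z, 0 <= t -> D z ->
      `|resp m1 t y z - resp m2 t y z| <= a / 2 * expR (c * t).
  move=> al1 al2 d1 d2 p1 p2 a0 l12 t y z t0 Dz.
  have e0 : 0 <= expR (c * t) by exact: expR_ge0.
  have ac0 : 0 <= a / (c + 1) by rewrite divr_ge0// addr_ge0.
  have := rspK (m1 t) (m2 t) (a / (c + 1) * expR (c * t)) (p1 _ t0) (p2 _ t0) _ _ y z Dz.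
  move=> /(_ _ _)/wrap[|y' A mA AD|H]; first exact: mulr_ge0.
    exact: (driven_by_dist cD laD a0 c0 (fun t y t0 => adm_bm _ t y al1 t0)
      (fun t y t0 => adm_bm _ t y al2 t0) d1 d2 l12 y' t0 mA AD).
  apply: le_trans H _; rewrite mulrA; apply: ler_wpM2r => //.
  rewrite mulrCA; apply: ler_wpM2l => //.
  by rewrite ler_pdivrMr ?ltr_wpDl// /c; lra.
have driven_eq l l' m : (forall (t : R) y z, 0 <= t -> D z -> l t y z = l' t y z) ->
    driven l m -> driven l' m.
  move=> ll dm A y mA AD; have [i0 cm dmt] := dm A y mA AD; split=> // t t0.
  apply: (is_derive_eq (dmt t t0)); congr (_ - _); apply: eq_Rintegral => z.
  by rewrite inE => /AD Dz; exact: ll (ltW t0) Dz.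
(* Stated for every [l], with the constant family [mu0] as a placeholder, so that choice yields a
   total solution operator [S]. *)
have ex l : exists m, adm l -> driven l m /\ prob m.
  have [al|nal] := pselect (adm l); last by exists (fun=> mu0).
  by have [m ? ?] := driven_by_exists cD laD mu0_prob C0 L0 M0 al; exists m.
have /choice[S SP] := ex.
pose step l := resp (S l).
have step_adm l : adm l -> adm (step l).
  move=> al; have [dm pm] := SP _ al; have [lC _ _ _] := al.
  by apply: resp_adm dm pm => // t y; exact: adm_bm.
pose lk k := iter k step (fun _ _ _ => 1).
have lk_adm k : adm (lk k).
  elim: k => [|k IHk]; last exact: step_adm.
  split=> [t y z _ _|t y z w _ _ _|s t y z _ _ _|t y _] /=.
  - by rewrite ler01.
  - by rewrite subrr normr0 mulr_ge0// sqrtr_ge0.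
  - by rewrite subrr normr0 mulr_ge0.
  - by rewrite Rintegral_cst// [X in fine X]laD mulr1.
have half a k : a / 2 ^+ k / 2 = a / 2 ^+ k.+1 :> R by rewrite exprSr invfM mulrA.
have step_contraction l l' k a : adm l -> adm l' -> 0 <= a ->
    (forall (t : R) y z, 0 <= t -> D z -> `|l t y z - l' t y z| <= a / 2 ^+ k * expR (c * t)) ->
    forall (t : R) y z, 0 <= t -> D z ->
      `|step l t y z - step l' t y z| <= a / 2 ^+ k.+1 * expR (c * t).
  move=> al al' a0 ll; rewrite -half.
  have [d1 p1] := SP _ al; have [d2 p2] := SP _ al'.
  have a1 : 0 <= a / 2 ^+ k by rewrite divr_ge0// exprn_ge0.
  exact: (contraction l l' (S l) (S l') _ al al' d1 d2 p1 p2 a1 ll).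
(* The first gap is at most [C], both densities lying between 0 and [C], and the weight is at least
   1. *)
have lk_cauchy k (t : R) y z : 0 <= t -> D z ->
    `|lk k.+1 t y z - lk k t y z| <= C / 2 ^+ k * expR (c * t).
  elim: k t y z => [|k IHk] t y z t0 Dz; last first.
    exact: (step_contraction (lk k.+1) (lk k) k C (lk_adm _) (lk_adm _) C0 IHk t y z t0 Dz).
  rewrite expr0 divr1 (le_trans (adm_gap (lk 1%N) (lk 0%N) t y z _ _ t0 Dz))//.
  by rewrite ler_peMr// -expR0 ler_expR mulr_ge0.
(* The limit is taken pointwise; the factor 2 is the sum of the geometric tail. *)
have /choice[l0 l0P] (p : R * {i01 R} * 'rV[R]_n) : exists x : R,
    0 <= p.1.1 -> D p.2 -> forall k,
    `|x - lk k p.1.1 p.1.2 p.2| <= 2 * C / 2 ^+ k * expR (c * p.1.1).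
  case: p => [[t y] z] /=.
  have [[t0 Dz]|nt] := pselect (0 <= t /\ D z); last first.
    by exists 0 => t0 Dz; exfalso; apply: nt.
  have [k|x hx] := @geometric_cauchy_limit R (fun k => lk k t y z) (C * expR (c * t)).
    by rewrite mulrAC; exact: lk_cauchy.
  by exists x => _ _ k; apply: le_trans (hx k) _; rewrite mulrA mulrAC.
pose l t y z := l0 (t, y, z).
have lP (t : R) y z k : 0 <= t -> D z ->
    `|l t y z - lk k t y z| <= 2 * C / 2 ^+ k * expR (c * t).
  by move=> t0 Dz; exact: (l0P (t, y, z)).
have lP' (t : R) y z k : 0 <= t -> D z ->
    `|l t y z - lk k t y z| <= 2 * C * expR (c * t) / 2 ^+ k.
  by move=> t0 Dz; rewrite mulrAC; exact: lP.
have l_adm : adm l.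
  (* Proved first because the measurability of [l], used for its unit mass, follows from it. *)
  have lL (t : R) y z w : 0 <= t -> D z -> D w ->
      `|l t y z - l t y w| <= L * enorm (z - w).
    move=> t0 Dz Dw; pose e := 2 * C * expR (c * t).
    apply: (@le_geometric _ _ _ (e + e)) => k; rewrite [X in _ <= _ + X]mulrDl.
    have [_ h _ _] := lk_adm k; move: (h t y z w t0 Dz Dw) (lP' t y z k t0 Dz) (lP' t y w k t0 Dw).
    rewrite -/e; move: (e / 2 ^+ k) (L * _) => e' q.
    by rewrite !ler_norml => /andP[? ?] /andP[? ?] /andP[? ?]; apply/andP; split; lra.
  split=> // [t y z t0 Dz|s t y z s0 t0 Dz|t y t0].
  - apply/andP; split; apply: (@le_geometric _ _ _ (2 * C * expR (c * t))) => k.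
      have [h _ _ _] := lk_adm k; have /andP[h1 h2] := h t y z t0 Dz.
      have := lP' t y z k t0 Dz; rewrite ler_norml => /andP[? ?]; lra.
    have [h _ _ _] := lk_adm k; have /andP[h1 h2] := h t y z t0 Dz.
    have := lP' t y z k t0 Dz; rewrite ler_norml => /andP[? ?]; lra.
  - pose e := 2 * C * expR (c * s); pose e' := 2 * C * expR (c * t).
    apply: (@le_geometric _ _ _ (e + e')) => k; rewrite [X in _ <= _ + X]mulrDl.
    have [_ _ h _] := lk_adm k; move: (h s t y z s0 t0 Dz) (lP' s y z k s0 Dz) (lP' t y z k t0 Dz).
    rewrite -/e -/e'; move: (e / 2 ^+ k) (e' / 2 ^+ k) (M * _) => f f' q.
    by rewrite !ler_norml => /andP[? ?] /andP[? ?] /andP[? ?]; apply/andP; split; lra.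
  - apply/eqP; rewrite -subr_eq0 -normr_le0; set e := 2 * C * expR (c * t).
    apply: (@le_geometric _ _ _ e) => k; rewrite add0r.
    have [_ _ _ h1] := lk_adm k; rewrite -[X in `|_ - X|](h1 t y t0) {h1}.
    apply: (normr_RintegralB_le mD laD mD) => //.
    + split; first exact: (enorm_lipschitz_measurable cD L0 (fun z w => lL t y z w t0)).
      exists (C + e) => z Dz.
      have [h _ _ _] := lk_adm 0%N; have /andP[h1 h2] := h t y z t0 Dz.
      have := lP' t y z 0%N t0 Dz; rewrite expr0 divr1 -/e !ler_norml => /andP[? ?].
      by apply/andP; split; lra.
    + by apply: adm_bm; [exact: lk_adm|].
    + apply: divr_ge0; last by rewrite exprn_ge0.
      by apply: mulr_ge0; [exact: mulr_ge0|exact: expR_ge0].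
    + by move=> z Dz; exact: lP'.
have [dm pm] := SP _ l_adm.
(* Both [l] and [step l] are close to [lk k.+1]: the former by construction, the latter by
   contraction from [lk k]. *)
have fixed (t : R) y z : 0 <= t -> D z -> l t y z = resp (S l) t y z.
  move=> t0 Dz; apply/eqP; rewrite -subr_eq0 -normr_le0.
  apply: (@le_geometric _ _ _ (2 * C * expR (c * t) + 2 * C * expR (c * t))) => k.
  rewrite add0r mulrDl.
  have h1 := lP' t y z k.+1 t0 Dz.
  have CC : 0 <= 2 * C by rewrite mulr_ge0.
  have h2 := step_contraction l (lk k) k (2 * C) l_adm (lk_adm k) CC
    (fun t y z t0 Dz => lP t y z k t0 Dz) t y z t0 Dz.
  have e : 2 * C * expR (c * t) / 2 ^+ k.+1 <= 2 * C * expR (c * t) / 2 ^+ k.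
    rewrite ler_wpM2l// ?mulr_ge0 ?expR_ge0// lef_pV2 ?posrE ?exprn_gt0//.
    by rewrite ler_eXn2l ?ltr1n.
  move: h1 h2 e; rewrite mulrAC /step /= -/(step (lk k)) -/(lk k.+1).
  move: (_ / 2 ^+ k.+1) (_ / 2 ^+ k) => p q.
  rewrite !ler_norml => /andP[? ?] /andP[? ?] ?; apply/andP; split; lra.
have dmr : driven (resp (S l)) (S l) by exact: driven_eq dm.
exists (S l); split=> [A y mA AD|//|nu nu_sol nu_prob t y A t0 mA AD].
  exact: dmr.
have dnu : driven (resp nu) nu by exact: nu_sol.
have anu : adm (resp nu).
  exact: (resp_adm _ _ (fun t y => resp_bm nu t y nu_prob)
    (fun t y z => resp_C nu t y z nu_prob) dnu nu_prob).
have amu : adm (resp (S l)).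
  exact: (resp_adm _ _ (fun t y => resp_bm _ t y pm) (fun t y z => resp_C _ t y z pm) dmr pm).
(* Each response drives its own family, so the contraction feeds the bound on the gap back into
   itself and halves it once more. *)
have gap k : forall (t : R) y z, 0 <= t -> D z ->
    `|resp nu t y z - resp (S l) t y z| <= C / 2 ^+ k * expR (c * t).
  elim: k => [|k IHk] s x z s0 Dz.
    rewrite expr0 divr1 (le_trans (adm_gap _ _ s x z anu amu s0 Dz))//.
    by rewrite ler_peMr// -expR0 ler_expR mulr_ge0.
  rewrite -half.
  apply: (contraction _ _ _ _ _ anu amu dnu dmr nu_prob pm _ IHk s x z s0 Dz).
  by rewrite divr_ge0// exprn_ge0.
(* Equality of the responses, written with the amplitude 0 that [driven_by_dist] takes. *)
have eqr (s : R) x z : 0 <= s -> D z -> `|resp nu s x z - resp (S l) s x z| <= 0 * expR (c * s).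
  move=> s0 Dz; rewrite mul0r; apply: (@le_geometric _ _ _ (C * expR (c * s))) => k.
  by rewrite add0r mulrAC; exact: gap.
have := driven_by_dist cD laD (lexx 0) c0 (fun t y t0 => adm_bm _ t y anu t0)
  (fun t y t0 => adm_bm _ t y amu t0) dnu dmr eqr y t0 mA AD.
rewrite !mul0r normr_le0 subr_eq0 => /eqP h.
by rewrite -[LHS]fineK ?fin_num_measure// h fineK// fin_num_measure.
Qed.
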